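(* Fix a small constant $\varepsilon>0$ (with $\varepsilon<1$). For each $r$, let $X$ and $Y$ be independently chosen random graphs in $\mathcal G(K_{r,r},p)$, where $p=p(r)\in[0,1]$ depends on $r$. (1) If $p(r)\leq\dfrac{1-\varepsilon}{r^{1/2}}$ for all $r$, then $\mathsf{FS}(X,Y)$ has more than $2$ connected components with high probability. (2) If $p(r)\geq\dfrac{5(\log r)^{1/10}}{r^{3/10}}$ for all (sufficiently large) $r$, then $\mathsf{FS}(X,Y)$ has exactly $2$ connected components with high probability.
   Context: All graphs are simple. For graphs $X$ and $Y$ with $|V(X)|=|V(Y)|$, the friends-and-strangers graph $\mathsf{FS}(X,Y)$ is the graph whose vertices are all bijections $\sigma:V(X)\to V(Y)$, where two bijections $\sigma,\sigma'$ are adjacent if and only if there is an edge $\{a,b\}\in E(X)$ such that $\{\sigma(a),\sigma(b)\}\in E(Y)$, $\sigma(a)=\sigma'(b)$, $\sigma(b)=\sigma'(a)$, and $\sigma(c)=\sigma'(c)$ for all $c\in V(X)\setminus\{a,b\}$. $K_{r,r}$ is the complete bipartite graph with both partite sets of size $r$. $\mathcal G(K_{r,r},p)$ is the probability space of random spanning subgraphs of $K_{r,r}$ in which each edge of $K_{r,r}$ appears independently with probability $p$. An event occurs with high probability if its probability tends to $1$ as $r\to\infty$. $\log$ is the natural logarithm. *)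

(* Defs.v *)
From HB Require Import structures.
From mathcomp Require Import all_boot all_order all_fingroup all_algebra.
From mathcomp Require Import all_classical all_reals all_analysis.
Set Implicit Arguments.
Unset Strict Implicit.
Unset Printing Implicit Defensive.

Import Order.TTheory GRing.Theory Num.Theory.
Import numFieldNormedType.Exports.

Local Open Scope ring_scope.

(* A simple graph on T is its set of edges, an edge being a 2-element set of
   vertices; so there are no loops and no multiple edges. *)
Record sgraph (T : finType) := SGraph {
  edges : {set {set T}};
  edgesP : [forall e in edges, #|e| == 2%N] }.

HB.instance Definition _ (T : finType) := [isSub for @edges T].
HB.instance Definition _ (T : finType) := [Finite of sgraph T by <:].

Definition adj (T : finType) (G : sgraph T) : rel T :=
  [rel x y | [set x; y]%SET \in edges G].

Lemma adj_neq (T : finType) (G : sgraph T) (x y : T) : adj G x y -> x != y.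
Proof.
by move=> xy; move/forall_inP: (edgesP G) => /(_ _ xy); rewrite cards2; case: (x != y).
Qed.

Definition num_components (T : finType) (G : sgraph T) : nat :=
  n_comp (adj G) predT.

Section FriendsAndStrangers.
Variables (T : finType) (X Y : sgraph T).

Definition fs_swap (s t : {perm T}) : bool :=
  [exists a, exists b,
    [&& [set a; b]%SET \in edges X, [set s a; s b]%SET \in edges Y,
        s a == t b, s b == t a
      & [forall c, (c \notin [set a; b]%SET) ==> (s c == t c)]]].

Lemma fs_swap_neq (s t : {perm T}) : fs_swap s t -> s != t.
Proof.
move=> /existsP[a /existsP[b /and5P[/adj_neq ab _ /eqP sa _ _]]].
by apply: contraNneq ab => st; move: sa; rewrite st => /perm_inj ->.
Qed.

Definition fs_edges : {set {set {perm T}}} :=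
  [set [set st.1; st.2] | st : {perm T} * {perm T} & fs_swap st.1 st.2]%SET.

Lemma fs_edgesP : [forall e in fs_edges, #|e| == 2%N].
Proof.
apply/forall_inP => e /imsetP[[s t]]; rewrite inE => /fs_swap_neq /= st ->.
by rewrite cards2 st.
Qed.

(* Both graphs live on the same vertex set T, so the bijections from V(X) to
   V(Y) are the permutations of T. *)
Definition friends_and_strangers : sgraph {perm T} := SGraph fs_edgesP.

End FriendsAndStrangers.

Section CompleteBipartite.
Variable r : nat.

Definition Krr_edges : {set {set 'I_r + 'I_r}} :=
  [set [set inl ij.1; inr ij.2] | ij : 'I_r * 'I_r]%SET.

Lemma Krr_edgesP : [forall e in Krr_edges, #|e| == 2%N].
Proof. by apply/forall_inP => e /imsetP[ij _ ->]; rewrite cards2. Qed.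

Definition Krr : sgraph ('I_r + 'I_r)%type := SGraph Krr_edgesP.

End CompleteBipartite.

Section RandomSubgraph.
Variables (R : realType) (T : finType) (G : sgraph T) (p : R).

(* Probability that the random spanning subgraph of G, with each edge of G
   kept independently with probability p, is exactly H. *)
Definition rsub_pmf (H : sgraph T) : R :=
  if edges H \subset edges G
  then \prod_(e in edges G) (if e \in edges H then p else 1 - p)
  else 0.

(* Probability of an event A about an independent pair (X, Y) of such random
   spanning subgraphs. *)
Definition rsub2_prob (A : sgraph T -> sgraph T -> bool) : R :=
  \sum_(XY : sgraph T * sgraph T | A XY.1 XY.2)
    rsub_pmf XY.1 * rsub_pmf XY.2.

End RandomSubgraph.

Definition whp (R : realType) (pr : nat -> R) : Prop :=
  (pr r @[r --> \oo] --> (1 : R))%classic.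

(* Main.v *)
Require Import Defs.
From HB Require Import structures.
From mathcomp Require Import all_boot all_order all_fingroup all_algebra.
From mathcomp Require Import all_classical all_reals all_analysis.
From mathcomp Require Import zify ring lra fintype finset.
Set Implicit Arguments.
Unset Strict Implicit.
Unset Printing Implicit Defensive.
Import Order.TTheory GRing.Theory Num.Theory.
Import numFieldNormedType.Exports.

(** In FS(X, Y) call the vertices of X positions, the vertices of Y persons, and
read a bijection s as placing the person [s x] at position [x]; an edge of
FS(X, Y) swaps two friends standing at adjacent positions.

A bijection is isolated as soon as it maps no edge of X onto an edge of Y.  The
argument of Sauer and Spencer gives one whenever 2 D(X) D(Y) < |V|, where D is
the maximum degree: in a bijection with a conflict at [a], all but at most
2 D(X) D(Y) positions [w] can trade persons with [a] without creating a
conflict, so conflicts can be removed one by one ([conflicts_decrease]).  Here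
|V| = 2r, so it is enough that all degrees are below the square root of r.  The
expected degrees are at most 1 - eps times that, and the exponential
moment bound [max_degree_prob] beats the number of vertices.  Both graphs being
bipartite, the quantity [fs_parity] is constant on components; it takes both
values, and the class of the isolated bijection has further members, so there are
at least three components.

For the dense range the goal is [exchange]: from every s one can reach the
arrangement in which the persons at [x] and [y] are exchanged, provided that [x]
and [y] lie on opposite sides and so do their persons; no adjacency is asked.
Such exchanges connect all bijections of equal parity
([connect_identity_or_tperm]), hence there are exactly two components.

The exchange rests on two properties of the pair (X, Y).  The minimum degrees are
large compared with m, and the pair is [mixing] at scale m: two families of m
(position, person) pairs, on opposite sides in both coordinates, always contain
members joined by an edge of X and simultaneously by an edge of Y.  Mixing
involves no bijection, so its failure costs a union bound over 4m vertices only,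
(2r)^(4m), against m^2 independent trials, (1 - p^2)^(m^2); it holds for m of
order log r / p^2.  Degrees are of order rp, so what is needed is that r p^3
exceeds a large multiple of log r, which for large r follows from
p >= 5 (log r)^(1/10) / r^(3/10).

Moves that avoid [x] and [y] can be replayed backwards once the two persons have
been exchanged ([exchange_move_off]), so the rest of the arrangement may first be
prepared at will.  By mixing, many friends of the person at [x] can be brought to
neighbors of [x], and likewise for [y] ([gather]).  Mixing applied to these places
then yields seven positions on which X and Y contain a fixed pair of small graphs,
and there an explicit word of fifteen swaps performs the exchange
([core_exchange]). *)

(** * Moves as left multiplication by transpositions *)

Lemma adj_sym (T : finType) (G : sgraph T) : symmetric (adj G).
Proof. by move=> a b; rewrite /adj /= setUC. Qed.

Section FriendsAndStrangersMoves.
Local Open Scope nat_scope.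
Local Open Scope group_scope.
Variables (T : finType) (X Y : sgraph T).
Implicit Types (s t : {perm T}).

Lemma fs_swap_tpermP s t :
  reflect (exists a b, [/\ adj X a b, adj Y (s a) (s b) & t = tperm a b * s])
          (fs_swap X Y s t).
Proof.
apply: (iffP existsP) => [[a /existsP[b /and5P[Xab Yab /eqP sa /eqP sb /forallP st]]]|].
  exists a, b; split=> //; apply/permP => z; rewrite permM.
  case: tpermP => [->|->|/eqP za /eqP zb] //.
  by apply/esym/eqP; apply: (implyP (st z)); rewrite !inE negb_or za.
move=> [a [b [Xab Yab ->]]]; exists a; apply/existsP; exists b.
move: Xab Yab; rewrite /adj /= => -> ->; rewrite !permM tpermL tpermR !eqxx /=.
apply/forallP => z; apply/implyP; rewrite !inE negb_or => /andP[za zb].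
by rewrite permM tpermD // eq_sym.
Qed.

Lemma fs_adjP s t :
  reflect (exists a b, [/\ adj X a b, adj Y (s a) (s b) & t = tperm a b * s])
          (adj (friends_and_strangers X Y) s t).
Proof.
apply: (iffP idP) => [/imsetP[[s' t']]|].
  rewrite inE /= => /fs_swap_tpermP[a [b [Xab Yab t'E]]] st.
  have /setP st' := st.
  have /orP : (s == s') || (s == t') by have := st' s; rewrite !inE eqxx.
  have /orP : (t == s') || (t == t') by have := st' t; rewrite !inE eqxx orbT => <-.
  have := st' s'; rewrite !inE eqxx /=.
  have := st' t'; rewrite !inE eqxx orbT => /orP tt' /orP ss'.
  have s't' : s' != t' by apply/fs_swap_neq/fs_swap_tpermP; exists a, b.
  case=> /eqP tE [] /eqP sE; subst s t; last 1 first.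
  - by case: ss' => /eqP ss'; rewrite ss' eqxx in s't'.
  - by case: tt' => /eqP tt'; rewrite tt' eqxx in s't'.
  - exists a, b; rewrite t'E !permM tpermL tpermR (adj_sym Y) Yab.
    by split=> //; rewrite mulgA tperm2 mul1g.
  - by exists a, b.
move=> [a [b st]]; apply/imsetP; exists (s, t) => //.
by rewrite inE /=; apply/fs_swap_tpermP; exists a, b.
Qed.

Lemma fs_connect_sym : connect_sym (adj (friends_and_strangers X Y)).
Proof. apply: sym_connect_sym => s t; exact: adj_sym. Qed.

End FriendsAndStrangersMoves.

(** * The parity invariant *)

Section Parity.
Local Open Scope nat_scope.
Local Open Scope group_scope.
Variables (T : finType) (side : pred T).
Implicit Types (s t : {perm T}).

Definition crossing (G : sgraph T) : Prop :=
  forall a b, adj G a b -> side a != side b.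

(** A swap is an odd permutation, and since it acts across the two sides of both
graphs it changes the number of persons of the left side standing on the left by
exactly one; the two effects cancel modulo 2. *)
Definition fs_parity s : bool :=
  odd_perm s (+) odd (\sum_z (side z && side (s z))).

Lemma fs_parity_adj (X Y : sgraph T) s t :
  crossing X -> crossing Y ->
  adj (friends_and_strangers X Y) s t -> fs_parity s = fs_parity t.
Proof.
move=> cX cY /fs_adjP[a [b [Xab Yab ->]]].
have ab := adj_neq Xab.
have /negP := cX _ _ Xab; have /negP := cY _ _ Yab.
rewrite /fs_parity odd_permM odd_tperm ab /=.
rewrite (bigD1 a) // (bigD1 b) /=; last by rewrite eq_sym.
rewrite [in RHS](bigD1 a) // [in RHS](bigD1 b) /=; last by rewrite eq_sym.
rewrite !permM tpermL tpermR.
under [in RHS]eq_bigr => z /andP[za zb].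
  rewrite permM tpermD; [|by rewrite eq_sym|by rewrite eq_sym]; over.
rewrite !oddD; case: (side a) (side b) (side (s a)) (side (s b)) => [] [] [] [] //= _ _;
  by case: (odd_perm s); case: (odd _).
Qed.

Lemma fs_parity_connect (X Y : sgraph T) s t :
  crossing X -> crossing Y ->
  connect (adj (friends_and_strangers X Y)) s t -> fs_parity s = fs_parity t.
Proof.
move=> cX cY /connectP[w]; elim: w s => [|s' w IH] s /=; first by move=> _ ->.
by move=> /andP[/(fs_parity_adj cX cY) -> /IH].
Qed.

Lemma fs_parity_tperm a b s : a != b -> side a = side b ->
  fs_parity (tperm a b * s) = ~~ fs_parity s.
Proof.
move=> ab sab; rewrite /fs_parity odd_permM odd_tperm ab.
have -> : \sum_z (side z && side ((tperm a b * s)%g z)) = \sum_z (side z && side (s z)).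
  rewrite [RHS](reindex_inj (@perm_inj _ (tperm a b))).
  apply: eq_bigr => z _; rewrite permM; congr (_ && _ : nat).
  by case: tpermP => [->|->|].
by rewrite addTb addNb.
Qed.

End Parity.

Lemma n_comp_ge3 (T : finType) (e : rel T) a b c : connect_sym e ->
  ~~ connect e a b -> ~~ connect e a c -> ~~ connect e b c ->
  (2 < n_comp e predT)%N.
Proof.
move=> esym ab ac bc.
pose S := [set fingraph.root e a; fingraph.root e b; fingraph.root e c].
have <- : #|S| = 3.
  rewrite /S -setUA cardsU1 cards2 !inE !(root_connect esym).
  by rewrite (negbTE ab) (negbTE ac) bc.
apply: subset_leq_card; apply/subsetP => z; rewrite !inE andbT.
by move=> /orP[/orP[]|] /eqP ->; exact: roots_root.
Qed.

Lemma n_comp_eq2 (T : finType) (e : rel T) a b : connect_sym e ->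
  ~~ connect e a b -> (forall z, connect e a z || connect e b z) ->
  n_comp e predT = 2%N.
Proof.
move=> esym ab abz; rewrite /n_comp_mem.
transitivity #|[set fingraph.root e a; fingraph.root e b]|; last first.
  by rewrite cards2 (root_connect esym) ab.
apply: eq_card => z; rewrite !inE andbT.
apply/idP/orP => [/eqP zr|[] /eqP ->]; [|exact: roots_root..].
by rewrite -zr !(root_connect esym); have /orP[] := abz z;
  rewrite esym; [left|right].
Qed.

(** * Isolated vertices *)

Section ConflictFree.
Local Open Scope nat_scope.
Variables (T : finType) (X Y : sgraph T).
Implicit Types (s : {perm T}).

Definition neighbors (G : sgraph T) a : {set T} := [set b | adj G a b].

Definition conflicts s : {set T * T} :=
  [set ab | adj X ab.1 ab.2 && adj Y (s ab.1) (s ab.2)].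

(** Let [ab] be a conflict.  Trading the persons at [a] and [w] can only create a
conflict if [w] is reached from [a] by an edge of X followed by an edge of Y
([F1]), or in the other order ([F2]).  Each of these sets has at most [d * d]
members, and [a] itself, through [b], is in both, so that their union has fewer
than [2 * (d * d)] members and leaves a choice of [w] other than [b]. *)
Lemma conflicts_decrease (d : nat) s :
  (forall a, #|neighbors X a| <= d) -> (forall a, #|neighbors Y a| <= d) ->
  2 * (d * d) < #|T| -> conflicts s != set0 ->
  exists t : {perm T}, #|conflicts t| < #|conflicts s|.
Proof.
move=> dX dY dT /set0Pn[[a b]]; rewrite inE /= => /andP[Xab Yab].
pose F1 := \bigcup_(c in neighbors X a) s @^-1: neighbors Y (s c).
pose F2 := \bigcup_(f in neighbors Y (s a)) neighbors X ((s^-1)%g f).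
have card_le (I : finType) (A : {set I}) (F : I -> {set T}) :
    #|A| <= d -> (forall i, #|F i| <= d) -> #|\bigcup_(i in A) F i| <= d * d.
  move=> Ad Fd; apply: (@leq_trans (\sum_(i in A) d)).
    elim/big_rec2: _ => [|i n U _ Un]; first by rewrite cards0.
    by apply: leq_trans (leq_card_setU _ _) _; apply: leq_add.
  by rewrite sum_nat_const leq_mul2r Ad orbT.
have F1d : #|F1| <= d * d.
  by apply: card_le => // c; rewrite card_preimset //; exact: perm_inj.
have F2d : #|F2| <= d * d by exact: card_le.
have aF1 : a \in F1.
  by apply/bigcupP; exists b; rewrite !inE // adj_sym.
have aF2 : a \in F2.
  by apply/bigcupP; exists (s b); rewrite !inE // permK adj_sym.
have F12 : #|F1 :|: F2| < 2 * (d * d).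
  have := cardsUI F1 F2; have : 0 < #|F1 :&: F2|.
    by apply/card_gt0P; exists a; rewrite inE aF1.
  move: F1d F2d; move: #|F1| #|F2| #|_ :&: _| #|_ :|: _| => *; lia.
have : 0 < #|~: (b |: (F1 :|: F2))|.
  have := cardsC (b |: (F1 :|: F2)); rewrite cardsU1.
  move: F12 dT; move: #|F1 :|: F2| #|~: _| => m k.
  by case: (b \notin _) => /=; lia.
move=> /card_gt0P[w]; rewrite !inE !negb_or => /and3P[wb wF1 wF2].
have wa : w != a by apply: contraNneq wF1 => ->.
(* An edge of X between [a] and [w] stays as it was, conflict or not. *)
exists (tperm a w * s)%g; apply: proper_card; apply/properP; split; last first.
  exists (a, b); rewrite !inE /= ?Xab //= !permM tpermL tpermD //; last first.
    exact: adj_neq Xab.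
  apply: contra wF1 => /= Y1; apply/bigcupP; exists b; rewrite !inE //.
  by rewrite adj_sym.
have key c : c != w -> adj X a c -> ~~ adj Y (s w) (s c).
  move=> cw Xac; apply: contra wF1 => Y1; apply/bigcupP; exists c; rewrite !inE //.
  by rewrite adj_sym.
have key' c : c != a -> adj X w c -> ~~ adj Y (s a) (s c).
  move=> ca Xwc; apply: contra wF2 => Y1; apply/bigcupP; exists (s c); rewrite !inE //.
  by rewrite permK adj_sym.
apply/subsetP => -[c e]; rewrite !inE /= !permM => /andP[Xce]; rewrite Xce /=.
have ce := adj_neq Xce.
case: (tpermP a w c) => [cE|cE|/eqP ca /eqP cw];
  case: (tpermP a w e) => [eE|eE|/eqP ea /eqP ew]; subst => //.
- by rewrite eqxx in ce.
- by rewrite adj_sym.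
- by rewrite (negbTE (key _ _ Xce)).
- by rewrite adj_sym.
- by rewrite eqxx in ce.
- by rewrite (negbTE (key' _ _ Xce)).
- by rewrite adj_sym (negbTE (key _ _ _)) // adj_sym.
- by rewrite adj_sym (negbTE (key' _ _ _)) // adj_sym.
Qed.

Lemma exists_conflict_free (d : nat) :
  (forall a, #|neighbors X a| <= d) -> (forall a, #|neighbors Y a| <= d) ->
  2 * (d * d) < #|T| -> exists s, conflicts s = set0.
Proof.
move=> dX dY dT.
have [s _ smin] := @arg_minnP {perm T} 1%g xpredT (fun s => #|conflicts s|) isT.
exists s; apply/eqP; apply/negPn/negP => /(conflicts_decrease dX dY dT)[t].
by rewrite ltnNge smin.
Qed.

Lemma conflict_free_isolated s : conflicts s = set0 ->
  forall t, connect (adj (friends_and_strangers X Y)) s t -> s = t.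
Proof.
move=> s0 t /connectP[[|s' w] /= ]; first by [].
move=> /andP[/fs_adjP[a [b [Xab Yab _]]] _ _].
by have := in_set0 (a, b); rewrite -s0 inE /= Xab Yab.
Qed.

End ConflictFree.

(** The isolated bijection [s] is one component.  Transposing two persons on one
side changes the parity, and doing so on both sides restores it: the latter
arrangement is not [s] but lies outside the component of the former. *)
Lemma max_degree_components (T : finType) (X Y : sgraph T) (side : pred T) (d : nat)
    (a1 a2 b1 b2 : T) :
  crossing side X -> crossing side Y ->
  side a1 -> side a2 -> ~~ side b1 -> ~~ side b2 -> a1 != a2 -> b1 != b2 ->
  (forall a, #|neighbors X a| <= d)%N -> (forall a, #|neighbors Y a| <= d)%N ->
  (2 * (d * d) < #|T|)%N ->
  (2 < num_components (friends_and_strangers X Y))%N.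
Proof.
move=> cX cY sa1 sa2 sb1 sb2 a12 b12 dX dY dT.
have [s s0] := exists_conflict_free dX dY dT.
have iso := conflict_free_isolated s0.
have pa : fs_parity side (tperm a1 a2 * s)%g = ~~ fs_parity side s.
  by apply: fs_parity_tperm; rewrite ?sa1 ?sa2.
have pb : fs_parity side (tperm b1 b2 * (tperm a1 a2 * s))%g = fs_parity side s.
  by rewrite fs_parity_tperm ?pa ?negbK // (negbTE sb1) (negbTE sb2).
apply: (n_comp_ge3 (a := s) (b := (tperm a1 a2 * s)%g)
         (c := (tperm b1 b2 * (tperm a1 a2 * s))%g)).
- exact: fs_connect_sym.
- by apply/negP => /(fs_parity_connect cX cY); rewrite pa; case: fs_parity.
- apply/negP => /iso /permP /(_ a1); rewrite !permM (tpermD (x := b1)).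
  + by rewrite tpermL => /perm_inj /eqP; rewrite (negbTE a12).
  + by apply: contraNneq sb1 => ->.
  + by apply: contraNneq sb2 => ->.
- by apply/negP => /(fs_parity_connect cX cY); rewrite pa pb; case: fs_parity.
Qed.

(** * Mixing pairs of graphs *)

Section Mixing.
Local Open Scope nat_scope.
Variables (T : finType) (side : pred T).

(** The functions [c], [f] list the positions and persons of one family and [b],
[g] those of the other.  The position and the person of a member need not be
matched by any particular bijection; this is what allows the two edges to be
attached at different places of a configuration under construction. *)
Definition mixing (m : nat) (X Y : sgraph T) : bool :=
  [forall c : {ffun 'I_m -> T}, forall b : {ffun 'I_m -> T},
   forall f : {ffun 'I_m -> T}, forall g : {ffun 'I_m -> T},
    [&& injectiveb c, injectiveb b, injectiveb f, injectiveb g,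
        [forall i, forall j, side (c i) != side (b j)] &
        [forall i, forall j, side (f i) != side (g j)]]
    ==> [exists i, exists j, adj X (c i) (b j) && adj Y (f i) (g j)]].

Lemma mixing_in (m : nat) (X Y : sgraph T) (I J : finType)
    (A : {set I}) (B : {set J}) (c f : I -> T) (b g : J -> T) :
  mixing m X Y -> m <= #|A| -> m <= #|B| ->
  {in A &, injective c} -> {in A &, injective f} ->
  {in B &, injective b} -> {in B &, injective g} ->
  {in A & B, forall i j, side (c i) != side (b j)} ->
  {in A & B, forall i j, side (f i) != side (g j)} ->
  exists i j, [/\ i \in A, j \in B, adj X (c i) (b j) & adj Y (f i) (g j)].
Proof.
move=> mix mA mB cI fI bI gI cb fg.
pose i_ (k : 'I_m) := enum_val (widen_ord mA k).
pose j_ (k : 'I_m) := enum_val (widen_ord mB k).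
have iA k : i_ k \in A by exact: enum_valP.
have jB k : j_ k \in B by exact: enum_valP.
have iI : injective i_ by move=> k l /enum_val_inj /(congr1 val) /= /val_inj.
have jI : injective j_ by move=> k l /enum_val_inj /(congr1 val) /= /val_inj.
move/forallP: mix => /(_ [ffun k => c (i_ k)]) /forallP /(_ [ffun k => b (j_ k)]).
move=> /forallP /(_ [ffun k => f (i_ k)]) /forallP /(_ [ffun k => g (j_ k)]).
rewrite (_ : [&& _, _, _, _, _ & _]) => [/existsP[k /existsP[l]]|].
  by rewrite !ffunE => /andP[Xcb Yfg]; exists (i_ k), (j_ l).
apply/and5P; split; last (apply/andP; split).
- by apply/injectiveP => k l; rewrite !ffunE => e; apply: iI; apply: cI.
- by apply/injectiveP => k l; rewrite !ffunE => e; apply: jI; apply: bI.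
- by apply/injectiveP => k l; rewrite !ffunE => e; apply: iI; apply: fI.
- by apply/injectiveP => k l; rewrite !ffunE => e; apply: jI; apply: gI.
- by apply/forallP => k; apply/forallP => l; rewrite !ffunE; exact: cb.
- by apply/forallP => k; apply/forallP => l; rewrite !ffunE; exact: fg.
Qed.

(** Greedily, mixing gives not one but [k] disjoint joined pairs.  The index sets
are arbitrary finite types so that [A] and [B] can themselves be matchings found
before, with [c], [f], [b], [g] reading off the vertices to be joined next. *)
Lemma mixing_matching (m k : nat) (X Y : sgraph T) (I J : finType)
    (A : {set I}) (B : {set J}) (c f : I -> T) (b g : J -> T) :
  mixing m X Y -> k + m <= #|A| -> k + m <= #|B| ->
  {in A &, injective c} -> {in A &, injective f} ->
  {in B &, injective b} -> {in B &, injective g} ->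
  {in A & B, forall i j, side (c i) != side (b j)} ->
  {in A & B, forall i j, side (f i) != side (g j)} ->
  exists M : {set I * J},
    [/\ #|M| = k, {in M &, injective fst}, {in M &, injective snd} &
        {in M, forall e, [/\ e.1 \in A, e.2 \in B,
                             adj X (c e.1) (b e.2) & adj Y (f e.1) (g e.2)]}].
Proof.
move=> mix kA kB cI fI bI gI cb fg; elim: k kA kB => [|k IH] kA kB.
  by exists set0; rewrite cards0; split=> // e; rewrite inE.
have [||M [Mk M1 M2 MP]] := IH; [by apply: leq_trans kA|by apply: leq_trans kB|].
pose A' := A :\: [set e.1 | e in M]; pose B' := B :\: [set e.2 | e in M].
have mA : m <= #|A'|.
  rewrite cardsD (leq_trans _ (leq_sub2l _ (subset_leq_card (subsetIr _ _)))) //.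
  by rewrite card_in_imset // Mk; lia.
have mB : m <= #|B'|.
  rewrite cardsD (leq_trans _ (leq_sub2l _ (subset_leq_card (subsetIr _ _)))) //.
  by rewrite card_in_imset // Mk; lia.
have A'A i : i \in A' -> i \in A by rewrite inE => /andP[].
have B'B j : j \in B' -> j \in B by rewrite inE => /andP[].
have [i [j [iA jB Xij Yij]]] := mixing_in mix mA mB
  (sub_in2 A'A cI) (sub_in2 A'A fI) (sub_in2 B'B bI) (sub_in2 B'B gI)
  (sub_in11 A'A B'B cb) (sub_in11 A'A B'B fg).
have i1 e : e \in M -> e.1 != i.
  move=> eM; move: iA; rewrite inE => /andP[+ _]; apply: contraNneq => <-.
  exact: imset_f.
have j2 e : e \in M -> e.2 != j.
  move=> eM; move: jB; rewrite inE => /andP[+ _]; apply: contraNneq => <-.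
  exact: imset_f.
exists ((i, j) |: M); split.
- rewrite cardsU1 Mk; case: (boolP (_ \in _)) => [/i1|//].
  by rewrite eqxx.
- move=> e e' /setU1P[->|eM] /setU1P[->|e'M] //=.
  + by move=> /esym/eqP; rewrite (negbTE (i1 _ e'M)).
  + by move=> /eqP; rewrite (negbTE (i1 _ eM)).
  + exact: M1.
- move=> e e' /setU1P[->|eM] /setU1P[->|e'M] //=.
  + by move=> /esym/eqP; rewrite (negbTE (j2 _ e'M)).
  + by move=> /eqP; rewrite (negbTE (j2 _ eM)).
  + exact: M2.
- by move=> e /setU1P[->|/MP //]; split; [exact: A'A|exact: B'B|..].
Qed.

End Mixing.

(** * Moves off a frozen set of positions *)

Section FrozenMoves.
Local Open Scope nat_scope.
Variables (T : finType) (X Y : sgraph T).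
Implicit Types (s t : {perm T}) (W : {set T}).

Definition move_off W : rel {perm T} := fun s t =>
  [exists a, exists b, [&& a \notin W, b \notin W, adj X a b,
     adj Y (s a) (s b) & t == (tperm a b * s)%g]].

Lemma move_offP W s t :
  reflect (exists a b, [/\ a \notin W, b \notin W, adj X a b,
             adj Y (s a) (s b) & t = (tperm a b * s)%g]) (move_off W s t).
Proof.
apply: (iffP existsP) => [[a /existsP[b /and5P[aW bW Xab Yab /eqP ->]]]|].
  by exists a, b.
move=> [a [b [aW bW Xab Yab ->]]]; exists a; apply/existsP; exists b.
by rewrite aW bW Xab Yab eqxx.
Qed.

Lemma move_off_fixed W s t : connect (move_off W) s t -> {in W, t =1 s}.
Proof.
move=> /connectP[w]; elim: w s => [|s' w IH] s /=; first by move=> _ ->.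
move=> /andP[/move_offP[a [b [aW bW _ _ s'E]]] sw tE] z zW.
rewrite (IH s') // s'E permM tpermD //; first by apply: contraNneq aW => ->.
by apply: contraNneq bW => ->.
Qed.

Lemma move_off_sub W W' s t : W' \subset W ->
  connect (move_off W) s t -> connect (move_off W') s t.
Proof.
move=> /subsetP W'W; apply: connect_sub => {}s {}t.
move=> /move_offP[a [b [aW bW Xab Yab tE]]]; apply: connect1.
by apply/move_offP; exists a, b; split=> //; [apply: contra aW|apply: contra bW];
  exact: W'W.
Qed.

Local Notation fs := (connect (adj (friends_and_strangers X Y))).

Lemma fs_move s a b : adj X a b -> adj Y (s a) (s b) -> fs s (tperm a b * s)%g.
Proof. by move=> Xab Yab; apply/connect1/fs_adjP; exists a, b. Qed.

(** A swap off [x] and [y] involves neither of the two persons standing there, so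
it commutes with exchanging them and remains legal afterwards. *)
Lemma exchange_move_off x y s t : connect (move_off [set x; y]) s t ->
  fs t (tperm x y * t)%g -> fs s (tperm x y * s)%g.
Proof.
move=> /connectP[w]; elim: w s => [|s' w IH] s /=; first by move=> _ ->.
move=> /andP[/move_offP[a [b [aW bW Xab Yab s'E]]] sw tE] ft.
have {IH sw tE ft} := IH _ sw tE ft; subst s' => f1.
move: aW bW; rewrite !inE !negb_or => /andP[ax ay] /andP[bx by_].
apply: connect_trans (fs_move Xab Yab) _; apply: connect_trans f1 _.
rewrite fs_connect_sym.
have -> : (tperm x y * (tperm a b * s) = tperm a b * (tperm x y * s))%g.
  rewrite !mulgA; congr (_ * _)%g; apply/permP => z; rewrite !permM.
  have [-> |zx] := eqVneq z x; first by rewrite tpermL !(tpermD ax, tpermD bx) // tpermD // ?tpermL // tpermD.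
  have [-> |zy] := eqVneq z y; first by rewrite tpermR !(tpermD (x := a)) // ?tpermR.
  rewrite (tpermD (x := x)) ?(eq_sym x) ?(eq_sym y) //.
  by case: (tpermP a b z) => [_|_|_ _]; rewrite (tpermD (x := x)) // eq_sym.
by apply: fs_move; rewrite // !permM !tpermD // eq_sym.
Qed.

End FrozenMoves.

(** * Bringing friends next to a person *)

Section Gathering.
Local Open Scope nat_scope.
Variables (T : finType) (side : pred T) (X Y : sgraph T) (m : nat).
Hypothesis crossX : crossing side X.
Hypothesis crossY : crossing side Y.
Hypothesis balanced : #|[set z | side z]| = #|[set z | ~~ side z]|.
Hypothesis mixXY : mixing side m X Y.
Implicit Types (s t : {perm T}) (W : {set T}).

(** Both the positions of one side and the positions hosting persons of one side
are half of all positions.  This is how a supply of vertices of one type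
guarantees the supply of the opposite type that mixing needs as partners. *)
Lemma card_opposite_types t (al be : bool) :
  #|[set z | (side z == al) && (side (t z) == be)]| =
  #|[set z | (side z != al) && (side (t z) != be)]|.
Proof.
have sideE ga : #|[set z | side z == ga]| = #|[set z | side z]|.
  case: ga; first by apply: eq_card => z; rewrite !inE eqb_id.
  by rewrite balanced; apply: eq_card => z; rewrite !inE eqbF_neg.
have neE ga z : (side z != ga) = (side z == ~~ ga) by case: (side z); case: ga.
have tE : #|[set z | side (t z) != be]| = #|[set z | side z == al]|.
  rewrite sideE -(sideE (~~ be)) -(card_preimset [set z | side z == ~~ be] (@perm_inj _ t)).
  by apply: eq_card => z; rewrite !inE neE.
have := cardsID [set z | side z == al] [set z | side (t z) != be].
rewrite tE -(cardsID [set z | side (t z) == be] [set z | side z == al]).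
set A := _ :&: _; set B := _ :\: _; set A' := _ :&: _; set B' := _ :\: _.
have -> : A = B' by apply/setP => z; rewrite !inE.
rewrite [RHS]addnC => /addnI AB; transitivity #|A'|.
  by apply: eq_card => z; rewrite !inE.
by rewrite -AB; apply: eq_card => z; rewrite !inE.
Qed.

Lemma mixing_move W t (A C : {set T}) :
  m <= #|A| -> m <= #|C| -> {in A, forall a, a \notin W} ->
  {in C, forall c, c \notin W} ->
  {in A & C, forall a c, side a != side c} ->
  {in A & C, forall a c, side (t a) != side (t c)} ->
  exists a c, [/\ a \in A, c \in C & move_off X Y W t (tperm a c * t)%g].
Proof.
move=> mA mC AW CW AC tAC.
have tI (D : {set T}) : {in D &, injective t} by move=> ? ? _ _; exact: perm_inj.
have idI (D : {set T}) : {in D &, injective (@id T)} by [].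
have [a [c [aA cC Xac Yac]]] := mixing_in mixXY mA mC (idI A) (tI A) (idI C) (tI C) AC tAC.
exists a, c; split=> //; apply/move_offP; exists a, c; split=> //; [exact: AW|exact: CW].
Qed.

Section Target.
Variables (W : {set T}) (x : T) (s : {perm T}) (M : nat).
Hypothesis xW : x \in W.
(* Each stage needs [m] candidates beyond the [M] found and beyond those lost to
   [W], once as candidates and once as partners in [spare]. *)
Hypothesis degX : 2 * #|W| + M + m <= #|neighbors X x|.
Hypothesis degY : 2 * #|W| + M + m <= #|neighbors Y (s x)|.
Local Notation u := (s x).

(** A friend of [u] can be moved directly to a neighbor of [x] only if it stands
on the side of [x] and the neighbor hosts a person on the side of [u].  The sets
[friends_near] and [open_places] collect the vertices ready for such a swap,
[settled] those where it has been done, and [spare] the partners by which other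
vertices are made ready. *)
Let friends_near t : {set T} :=
  [set a | [&& a \notin W, side a == side x & adj Y u (t a)]].
Let open_places t : {set T} :=
  [set b | [&& b \notin W, adj X x b & side (t b) == side u]].
Let settled t : {set T} :=
  [set b | [&& b \notin W, adj X x b & adj Y u (t b)]].
Let spare t : {set T} :=
  [set c | [&& c \notin W, side c == side x & side (t c) == side u]].

Lemma card_spare t (A : {set T}) :
  {in A, forall a, side a != side x} -> {in A, forall a, side (t a) != side u} ->
  #|A| <= #|spare t| + #|W|.
Proof.
move=> A1 A2.
apply: (@leq_trans #|[set z | (side z == side x) && (side (t z) == side u)]|).
  rewrite card_opposite_types; apply: subset_leq_card; apply/subsetP => a aA.
  by rewrite inE A1 // A2.
apply: leq_trans (leq_card_setU _ _); apply: subset_leq_card; apply/subsetP => a.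
by rewrite !inE; case: (a \in W); rewrite ?orbT ?orbF.
Qed.

(** Friends of [u] standing on the wrong side are at positions of the type
opposite to [spare], so if there are many of them one can be swapped over. *)
Lemma gather_friends_near k : k <= M ->
  exists2 t, connect (move_off X Y W) s t & k <= #|friends_near t|.
Proof.
elim: k => [_|k IH kM]; first by exists s.
have [t st] := IH (ltnW kM); rewrite leq_eqVlt => /orP[/eqP kE|kt]; last by exists t.
pose A := [set a | [&& a \notin W, side a != side x & adj Y u (t a)]].
have A1 : {in A, forall a, side a != side x} by move=> a; rewrite inE => /and3P[].
have A2 : {in A, forall a, side (t a) != side u}.
  by move=> a; rewrite inE => /and3P[_ _ /crossY]; rewrite eq_sym.
have cA : #|neighbors Y u| <= #|A| + k + #|W|.
  rewrite -(card_preimset (neighbors Y u) (@perm_inj _ t)) kE.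
  apply: leq_trans (leq_trans (leq_card_setU _ W) (leq_add (leq_card_setU A (friends_near t)) (leqnn _))).
  apply: subset_leq_card; apply/subsetP => a; rewrite !inE => ->.
  by case: (a \in W); case: (side a == _).
have cS := card_spare A1 A2.
have mA : m <= #|A| by move: cA degY; move: #|A| #|neighbors Y u| #|W| kM => *; lia.
have mS : m <= #|spare t|.
  by move: cS cA degY; move: #|A| #|spare t| #|neighbors Y u| #|W| kM => *; lia.
have [||||a [c [aA cS' tt']]] := @mixing_move W t A (spare t) mA mS.
- by move=> a; rewrite inE => /and3P[].
- by move=> a; rewrite inE => /and3P[].
- by move=> a c /A1 ax; rewrite inE => /and3P[_ /eqP -> _].
- by move=> a c /A2 ax; rewrite inE => /and3P[_ _ /eqP ->].
exists (tperm a c * t)%g; first exact: connect_trans st (connect1 tt').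
move: aA cS'; rewrite !inE => /and3P[aW ax aF] /and3P[cW cx cu].
have cN : c \notin friends_near t.
  rewrite inE cW cx /=; apply: contraL cu => /crossY.
  by rewrite eq_sym.
apply: leq_trans (_ : #|c |: friends_near t| <= _); first by rewrite cardsU1 cN kE.
apply: subset_leq_card; apply/subsetP => z; rewrite !inE permM => /orP[/eqP ->|].
  by rewrite cW cx tpermR.
move=> /and3P[zW zx zF]; rewrite zW zx tpermD //.
  by apply: contraNneq ax => ->.
by apply: contraTneq zF => <-; apply: contraTN cu => /crossY; rewrite eq_sym.
Qed.

(** The same step in the dual form: neighbors of [x] hosting a person of the wrong
side.  Such a swap cannot undo the previous stage, as neither of its two positions
is in [friends_near]. *)
Lemma gather_open_places k : k <= M ->
  exists t, [/\ connect (move_off X Y W) s t, M <= #|friends_near t| &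
                k <= #|open_places t|].
Proof.
elim: k => [_|k IH kM].
  by have [t st tM] := gather_friends_near (leqnn M); exists t.
have [t [st tM]] := IH (ltnW kM); rewrite leq_eqVlt => /orP[/eqP kE|kt]; last by exists t.
pose A := [set b | [&& b \notin W, adj X x b & side (t b) != side u]].
have A1 : {in A, forall a, side a != side x}.
  by move=> a; rewrite inE => /and3P[_ /crossX + _]; rewrite eq_sym.
have A2 : {in A, forall a, side (t a) != side u} by move=> a; rewrite inE => /and3P[].
have cA : #|neighbors X x| <= #|A| + k + #|W|.
  rewrite kE.
  apply: leq_trans (leq_trans (leq_card_setU _ W) (leq_add (leq_card_setU A (open_places t)) (leqnn _))).
  apply: subset_leq_card; apply/subsetP => a; rewrite !inE => ->.
  by case: (a \in W); case: (side (t a) == _).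
have cS := card_spare A1 A2.
have mA : m <= #|A| by move: cA degX; move: #|A| #|neighbors X x| #|W| kM => *; lia.
have mS : m <= #|spare t|.
  by move: cS cA degX; move: #|A| #|spare t| #|neighbors X x| #|W| kM => *; lia.
have [||||b [c [bA cS' tt']]] := @mixing_move W t A (spare t) mA mS.
- by move=> a; rewrite inE => /and3P[].
- by move=> a; rewrite inE => /and3P[].
- by move=> a c /A1 ax; rewrite inE => /and3P[_ /eqP -> _].
- by move=> a c /A2 ax; rewrite inE => /and3P[_ _ /eqP ->].
have bx := A1 _ bA.
move: bA cS'; rewrite !inE => /and3P[bW xb bu] /and3P[cW cx cu].
exists (tperm b c * t)%g; split; first exact: connect_trans st (connect1 tt').
  apply: leq_trans tM _; apply: subset_leq_card; apply/subsetP => z.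
  rewrite !inE permM => /and3P[zW zx zF]; rewrite zW zx tpermD //.
    by apply: contraNneq bx => ->.
  by apply: contraTneq zF => <-; apply: contraTN cu => /crossY; rewrite eq_sym.
have bN : b \notin open_places t by rewrite inE bW xb.
apply: leq_trans (_ : #|b |: open_places t| <= _); first by rewrite cardsU1 bN kE.
apply: subset_leq_card; apply/subsetP => z; rewrite !inE permM => /orP[/eqP ->|].
  by rewrite bW xb tpermL.
move=> /and3P[zW xz zu]; rewrite zW xz tpermD //.
  by apply: contraNneq bu => ->.
by apply: contraTneq xz => <-; apply: contraTN cx => /crossX; rewrite eq_sym.
Qed.

(** Swaps between [friends_near] and [open_places] settle one friend each and use
up one member of either set; mixing provides them until [m] members are left. *)
Lemma gather : exists t (B : {set T}),
  [/\ connect (move_off X Y W) s t, #|B| = M - m &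
      {in B, forall b, [/\ b \notin W, adj X x b & adj Y u (t b)]}].
Proof.
suff /(_ (M - m) (leqnn _)) [t [st _ _ tS]] : forall k, k <= M - m -> exists t,
    [/\ connect (move_off X Y W) s t, M - k <= #|friends_near t|,
        M - k <= #|open_places t| & k <= #|settled t|].
  have /card_geqP[l [lu lk lS]] := tS; exists t, [set z in l]; split=> //.
    by rewrite cardsE (card_uniqP lu).
  by move=> z; rewrite inE => /lS; rewrite inE => /and3P[].
elim=> [_|k IH kM].
  by have [t [st tM tM']] := gather_open_places (leqnn M); exists t; rewrite subn0.
have [t [st kF kO kS]] := IH (ltnW kM).
have [||||||a [b [aF bO tt']]] := @mixing_move W t (friends_near t) (open_places t).
- by apply: leq_trans kF; lia.
- by apply: leq_trans kO; lia.
- by move=> a; rewrite inE => /and3P[].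
- by move=> a; rewrite inE => /and3P[].
- move=> a b; rewrite !inE => /and3P[_ /eqP -> _] /and3P[_ /crossX + _].
  by [].
- move=> a b; rewrite !inE => /and3P[_ _ /crossY + ] /and3P[_ _ /eqP ->].
  by rewrite eq_sym.
exists (tperm a b * t)%g; split; first exact: connect_trans st (connect1 tt').
- apply: leq_trans (_ : #|friends_near t :\ a| <= _).
    by move: kF; rewrite (cardsD1 a) aF; lia.
  apply: subset_leq_card; apply/subsetP => z; move: bO; rewrite !inE permM.
  move=> /and3P[_ _ bu] /and4P[za zW zx zF]; rewrite zW zx tpermD //; first by rewrite eq_sym.
  by apply: contraTneq zF => <-; apply: contraTN bu => /crossY; rewrite eq_sym.
- apply: leq_trans (_ : #|open_places t :\ b| <= _).
    by move: kO; rewrite (cardsD1 b) bO; lia.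
  apply: subset_leq_card; apply/subsetP => z; move: aF; rewrite !inE permM.
  move=> /and3P[_ ax _] /and4P[zb zW xz zu]; rewrite zW xz tpermD //; last by rewrite eq_sym.
  by apply: contraTneq xz => <-; apply: contraTN ax => /crossX; rewrite eq_sym.
move: aF bO; rewrite !inE => /and3P[aW ax aF] /and3P[bW xb bu].
have bN : b \notin settled t.
  by rewrite inE bW xb /=; apply: contraTN bu => /crossY; rewrite eq_sym.
apply: leq_trans (_ : #|b |: settled t| <= _); first by rewrite cardsU1 bN.
apply: subset_leq_card; apply/subsetP => z; rewrite !inE permM => /orP[/eqP ->|].
  by rewrite bW xb tpermR.
move=> /and3P[zW xz zF]; rewrite zW xz tpermD //.
  by apply: contraTneq xz => <-; apply: contraTN ax => /crossX; rewrite eq_sym.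
by apply: contraTneq zF => <-; apply: contraTN bu => /crossY; rewrite eq_sym.
Qed.

End Target.
End Gathering.

(** * Exchanging two persons *)

Section SwapWords.
Local Open Scope nat_scope.
Variables (T : finType) (X Y : sgraph T).
Implicit Types (s t : {perm T}) (l : seq nat) (E F : seq (nat * nat)).
Local Notation fs := (connect (adj (friends_and_strangers X Y))).

(** The word is run on a small model: positions are numbered, [l] lists the number
of the person at each position, and [E], [F] are the edges of the two model
graphs.  The result is [None] if some swap is illegal. *)
Fixpoint swap_word E F l (w : seq (nat * nat)) : option (seq nat) :=
  if w is (a, b) :: w' then
    let i := nth 0 l a in let j := nth 0 l b in
    if ((a, b) \in E) && (((i, j) \in F) || ((j, i) \in F)) then
      swap_word E F (set_nth 0 (set_nth 0 l a j) b i) w'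
    else None
  else Some l.

Section Embedded.
Variables (x0 : T) (ps : seq T) (E F : seq (nat * nat)) (s : {perm T}).
Local Notation pos i := (nth x0 ps i).
Hypothesis ps_uniq : uniq ps.
Hypothesis EX : {in E, forall e, [&& e.1 < size ps, e.2 < size ps & adj X (pos e.1) (pos e.2)]}.
Hypothesis FY : {in F, forall e, adj Y (s (pos e.1)) (s (pos e.2))}.

Let arranged l t : Prop :=
  [/\ size l = size ps, forall i, i < size ps -> t (pos i) = s (pos (nth 0 l i)) &
      forall z, z \notin ps -> t z = s z].

Lemma swap_word_connect w l l' t : swap_word E F l w = Some l' -> arranged l t ->
  exists2 t', fs t t' & arranged l' t'.
Proof.
elim: w l t => [|[a b] w IH] l t /=; first by move=> [<-] lt; exists t.
case: ifP => // /andP[abE ijF] wl' [lsz lt l0].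
have /and3P[/= az bz Xab] := EX abE.
have Yab : adj Y (t (pos a)) (t (pos b)).
  by rewrite !lt //; case/orP: ijF => /FY //; rewrite adj_sym.
have ab : a != b by apply: contraTneq Xab => ->; apply/negP => /adj_neq; rewrite eqxx.
have [|t' tt' ?] := IH _ (tperm (pos a) (pos b) * t)%g wl'; last first.
  by exists t' => //; apply: connect_trans tt'; exact: fs_move.
split; first by rewrite !size_set_nth lsz; lia.
  move=> i iz; rewrite permM !nth_set_nth /= nth_set_nth /=.
  have [->|ib] := eqVneq i b; first by rewrite tpermR lt.
  have [->|ia] := eqVneq i a; first by rewrite tpermL lt.
  by rewrite tpermD ?lt // nth_uniq // eq_sym.
move=> z zp; rewrite permM tpermD ?l0 //; apply: contraNneq zp => <-; exact: mem_nth.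
Qed.

Lemma swap_word_exchange w : 1 < size ps ->
  swap_word E F (iota 0 (size ps)) w = Some [:: 1, 0 & iota 2 (size ps).-2] ->
  fs s (tperm (pos 0) (pos 1) * s)%g.
Proof.
move=> ps1 run_w; have [|t st [tsz tp t0]] := @swap_word_connect w _ _ s run_w.
  by split=> [|i iz|//]; rewrite ?size_iota // nth_iota.
suff <- : t = (tperm (pos 0) (pos 1) * s)%g by [].
apply/permP => z; rewrite permM; case: (boolP (z \in ps)) => [zp|zp]; last first.
  rewrite t0 // tpermD //; apply: contraNneq zp => <-; apply: mem_nth => //.
  exact: ltnW.
rewrite -(nth_index x0 zp); have := zp; rewrite -index_mem; move: (index z ps) => i iz.
rewrite tp //; case: i iz => [|[|i]] iz /=; first by rewrite tpermL.
  by rewrite tpermR.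
rewrite nth_iota; last by case: (size ps) iz => [|[|n]].
by rewrite tpermD ?nth_uniq // ltnW.
Qed.

End Embedded.

(** In the model, [x], [y], [b1], [b2], [d1], [d2], [d3] have the numbers 0 to 6.
The word is a shortest path, found by exhaustive search, in the graph FS of the two
model graphs; these have nine edges each, and neither of them joins 0 to 1. *)
Lemma core_exchange s (x y b1 b2 d1 d2 d3 : T) :
  uniq [:: x; y; b1; b2; d1; d2; d3] ->
  all (adj X x) [:: b1; b2] -> all (adj X y) [:: d1; d2; d3] ->
  all (adj Y (s x)) [:: s b1; s b2] -> all (adj Y (s y)) [:: s d1; s d2; s d3] ->
  adj X b1 d3 -> adj Y (s b1) (s d3) -> adj X b2 d1 -> adj Y (s b2) (s d1) ->
  adj X b1 d1 -> adj Y (s b1) (s d1) -> adj X b2 d2 -> adj Y (s b1) (s d2) ->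
  fs s (tperm x y * s)%g.
Proof.
move=> ps_uniq /and3P[x1 x2 _] /and4P[y1 y2 y3 _] /and3P[u1 u2 _] /and4P[v1 v2 v3 _].
move=> X13 Y13 X21 Y21 X11 Y11 X22 Y12.
pose E := [:: (0, 2); (0, 3); (1, 4); (1, 5); (1, 6); (2, 6); (3, 4); (2, 4); (3, 5)].
pose F := [:: (0, 2); (0, 3); (1, 4); (1, 5); (1, 6); (2, 6); (3, 4); (2, 4); (2, 5)].
pose w := [:: (0, 3); (1, 5); (2, 6); (1, 6); (1, 4); (1, 5); (1, 6); (2, 6);
              (3, 4); (3, 5); (0, 3); (0, 2); (1, 5); (1, 4); (2, 4)].
apply: (@swap_word_exchange x _ E F s ps_uniq _ _ w) => //.
  by apply/allP; rewrite /= x1 x2 y1 y2 y3 X13 X21 X11 X22.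
by apply/allP; rewrite /= u1 u2 v1 v2 v3 Y13 Y21 Y11 Y12.
Qed.

End SwapWords.

Section Exchange.
Local Open Scope nat_scope.
Variables (T : finType) (side : pred T) (X Y : sgraph T) (m : nat).
Hypothesis crossX : crossing side X.
Hypothesis crossY : crossing side Y.
Hypothesis balanced : #|[set z | side z]| = #|[set z | ~~ side z]|.
Hypothesis mixXY : mixing side m X Y.
Hypothesis degX : forall a, 29 * m + 4 <= #|neighbors X a|.
Hypothesis degY : forall a, 29 * m + 4 <= #|neighbors Y a|.
Local Notation fs := (connect (adj (friends_and_strangers X Y))).

Lemma subset_card_eq (A : {set T}) k : k <= #|A| -> exists2 B : {set T}, B \subset A & #|B| = k.
Proof.
move=> /card_geqP[l [lu lk lA]]; exists [set z in l].
  by apply/subsetP => z; rewrite inE => /lA.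
by rewrite cardsE (card_uniqP lu).
Qed.

(** Five disjoint subfamilies of [B] and [D] are assembled into the model: first
disjoint pairs [(b1, d3)] and [(b2, d1)], then pairs of pairs joined along [b1] and
[d1].  In the last step the edge of X joins [b2] to [d2], and the edge of Y joins the
person at [b1] to the person at [d2]. *)
Lemma prepared_exchange (s : {perm T}) x y (B D : {set T}) :
  side x != side y -> side (s x) != side (s y) -> 9 * m <= #|B| -> 9 * m <= #|D| ->
  {in B, forall b, [/\ b != x, b != y, adj X x b & adj Y (s x) (s b)]} ->
  {in D, forall d, [/\ d != x, d != y, adj X y d & adj Y (s y) (s d)]} ->
  fs s (tperm x y * s)%g.
Proof.
move=> xy sxy cB cD BP DP.
have [|B1 B1B cB1] := @subset_card_eq B (4 * m); first by apply: leq_trans cB; lia.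
have [|B2 B2B cB2] := @subset_card_eq (B :\: B1) (4 * m).
  by rewrite cardsD (setIidPr B1B) cB1; lia.
have [|D1 D1D cD1] := @subset_card_eq D (4 * m); first by apply: leq_trans cD; lia.
have [|D3 D3D cD3] := @subset_card_eq (D :\: D1) (4 * m).
  by rewrite cardsD (setIidPr D1D) cD1; lia.
have [|D2 D2D cD2] := @subset_card_eq (D :\: D1 :\: D3) m.
  rewrite cardsD (setIidPr D3D) cD3 cardsD (setIidPr D1D) cD1.
  by move: #|D| cD => k kD; clear -kD; lia.
have B1i b : b \in B1 -> b \in B by move/(subsetP B1B).
have B2i b : b \in B2 -> b \in B by move/(subsetP B2B); rewrite inE => /andP[].
have D1i b : b \in D1 -> b \in D by move/(subsetP D1D).
have D3i b : b \in D3 -> b \in D by move/(subsetP D3D); rewrite inE => /andP[].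
have D2i b : b \in D2 -> b \in D by move/(subsetP D2D); rewrite !inE => /and3P[].
have BD : {in B & D, forall b d, side b != side d}.
  move=> b d /BP[_ _ /crossX xb _] /DP[_ _ /crossX yd _].
  by move: xy xb yd; case: (side x) (side y) (side b) (side d) => [] [] [] [].
have sBD : {in B & D, forall b d, side (s b) != side (s d)}.
  move=> b d /BP[_ _ _ /crossY xb] /DP[_ _ _ /crossY yd].
  by move: sxy xb yd; case: (side (s x)) (side (s y)) (side (s b)) (side (s d)) => [] [] [] [].
have idI (A : {set T}) : {in A &, injective (@id T)} by [].
have sI (A : {set T}) : {in A &, injective s} by move=> ? ? _ _; exact: perm_inj.
have [||M1 [cM1 M11 M12 M1P]] := @mixing_matching _ side m (3 * m) X Y _ _ B1 D3
   id s id s mixXY _ _ (idI _) (sI _) (idI _) (sI _) (sub_in11 B1i D3i BD) (sub_in11 B1i D3i sBD).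
- by rewrite cB1 -mulSnr.
- by rewrite cD3 -mulSnr.
have [||M2 [cM2 M21 M22 M2P]] := @mixing_matching _ side m (3 * m) X Y _ _ B2 D1
   id s id s mixXY _ _ (idI _) (sI _) (idI _) (sI _) (sub_in11 B2i D1i BD) (sub_in11 B2i D1i sBD).
- by rewrite cB2 -mulSnr.
- by rewrite cD1 -mulSnr.
have [||||||||M3 [cM3 M31 M32 M3P]] := @mixing_matching _ side m m X Y _ _ M1 M2
   fst (fun e => s e.1) snd (fun e => s e.2) mixXY.
- by rewrite cM1 addnn -mul2n leq_mul2r orbT.
- by rewrite cM2 addnn -mul2n leq_mul2r orbT.
- exact: M11.
- by move=> e e' eM e'M /perm_inj; exact: M11.
- exact: M22.
- by move=> e e' eM e'M /perm_inj; exact: M22.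
- by move=> e e' /M1P[/B1i eB _ _ _] /M2P[_ /D1i eD _ _]; exact: BD.
- by move=> e e' /M1P[/B1i eB _ _ _] /M2P[_ /D1i eD _ _]; exact: sBD.
(* The positions of this family are the [b2], its persons those of the [b1]. *)
have [||||||||[[b1 d3] [b2 d1]] [d2 [eM3 d2D X22 Y12]]] := @mixing_in _ side m X Y _ _ M3 D2
   (fun e => e.2.1) (fun e => s e.1.1) id s mixXY.
- by rewrite cM3.
- by rewrite cD2.
- move=> e e' eM e'M ee'; apply: M32 => //; apply: M21 => //.
    by have [] := M3P _ eM.
  by have [] := M3P _ e'M.
- move=> e e' eM e'M /perm_inj ee'; apply: M31 => //; apply: M11 => //.
    by have [] := M3P _ eM.
  by have [] := M3P _ e'M.
- exact: idI.
- exact: sI.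
- by move=> e d /M3P[_ /M2P[/B2i eB _ _ _] _ _] /D2i; exact: BD.
- by move=> e d /M3P[/M1P[/B1i eB _ _ _] _ _ _] /D2i; exact: sBD.
have [/= /M1P[/= b1B d3D X13 Y13] /M2P[/= b2B d1D X21 Y21] X11 Y11] := M3P _ eM3.
move: X22 Y12 => /= X22 Y12.
have [b1x b1y xb1 ub1] := BP _ (B1i _ b1B); have [b2x b2y xb2 ub2] := BP _ (B2i _ b2B).
have [d1x d1y yd1 vd1] := DP _ (D1i _ d1D); have [d2x d2y yd2 vd2] := DP _ (D2i _ d2D).
have [d3x d3y yd3 vd3] := DP _ (D3i _ d3D).
have bd b d : b \in B -> d \in D -> b != d.
  by move=> bB dD; apply: contraNneq (BD _ _ bB dD) => ->.
apply: (core_exchange (b1 := b1) (b2 := b2) (d1 := d1) (d2 := d2) (d3 := d3)) => //=.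
- have b12 : b1 != b2 by move/(subsetP B2B): b2B; rewrite inE => /andP[+ _]; apply: contraNneq => <-.
  have d13 : d1 != d3 by move/(subsetP D3D): d3D; rewrite inE => /andP[+ _]; apply: contraNneq => <-.
  have /and3P[d23 d12 _] : [&& d2 \notin D3, d2 \notin D1 & d2 \in D].
    by move/(subsetP D2D): d2D; rewrite !inE.
  have d2d1 : d1 != d2 by apply: contraNneq d12 => <-.
  have d2d3 : d2 != d3 by apply: contraNneq d23 => ->.
  have xy' : x != y by apply: contraNneq xy => ->.
  rewrite !inE !negb_or xy' b12 d2d1 d13 d2d3 !(eq_sym x) !(eq_sym y).
  rewrite b1x b2x d1x d2x d3x b1y b2y d1y d2y d3y.
  by rewrite !bd //; first [exact: B1i|exact: B2i|exact: D1i|exact: D2i|exact: D3i].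
- by rewrite xb1 xb2.
- by rewrite yd1 yd2 yd3.
- by rewrite ub1 ub2.
- by rewrite vd1 vd2 vd3.
Qed.

(** The friends gathered around [x] are frozen while those around [y] are
gathered, which explains the constants: the second frozen set has up to [9 * m + 2]
positions. *)
Theorem exchange (s : {perm T}) x y :
  side x != side y -> side (s x) != side (s y) -> fs s (tperm x y * s)%g.
Proof.
move=> xy sxy.
have W2 : #|[set x; y]| <= 2 by rewrite cards2; case: (_ != _).
have [|||t1 [B [st1 cB BP]]] :=
  @gather _ side X Y m crossX crossY balanced mixXY [set x; y] x s (10 * m).
- by rewrite !inE eqxx.
- by apply: leq_trans (degX x); lia.
- by apply: leq_trans (degY _); lia.
have cW : #|[set x; y] :|: B| <= 9 * m + 2.
  by apply: leq_trans (leq_card_setU _ _) _; rewrite cB; lia.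
have [|||t2 [D [t12 cD DP]]] :=
  @gather _ side X Y m crossX crossY balanced mixXY ([set x; y] :|: B) y t1 (10 * m).
- by rewrite !inE eqxx orbT.
- by apply: leq_trans (degX y); lia.
- by apply: leq_trans (degY _); lia.
have fix1 := move_off_fixed st1; have fix2 := move_off_fixed t12.
have st2 : connect (move_off X Y [set x; y]) s t2.
  by apply: connect_trans st1 (move_off_sub _ t12); exact: subsetUl.
have fix12 := move_off_fixed st2.
have t2x : t2 x = s x by apply: fix12; rewrite !inE eqxx.
have t2y : t2 y = s y by apply: fix12; rewrite !inE eqxx orbT.
apply: exchange_move_off st2 _.
apply: (@prepared_exchange t2 x y B D) => //.
- by rewrite t2x t2y.
- by rewrite cB; lia.
- by rewrite cD; lia.
- move=> b bB; have [bW xb ub] := BP _ bB.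
  move: bW; rewrite !inE negb_or => /andP[-> ->]; split=> //.
  by rewrite t2x fix2 // !inE bB orbT.
- move=> d dD; have [dW yd vd] := DP _ dD.
  move: dW; rewrite !inE !negb_or => /andP[/andP[-> ->] _]; split=> //.
  by rewrite fix2 // !inE eqxx orbT.
Qed.

End Exchange.

(** * From exchanges to two components *)

Section TwoComponents.
Local Open Scope nat_scope.
Variables (T : finType) (side : pred T) (X Y : sgraph T) (a1 a2 b1 b2 : T).
Hypothesis crossX : crossing side X.
Hypothesis crossY : crossing side Y.
Hypothesis balanced : #|[set z | side z]| = #|[set z | ~~ side z]|.
Hypotheses (sa1 : side a1) (sa2 : side a2) (a12 : a1 != a2).
Hypotheses (sb1 : ~~ side b1) (sb2 : ~~ side b2) (b12 : b1 != b2).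
Implicit Types (s t : {perm T}).
Local Notation fs := (connect (adj (friends_and_strangers X Y))).
Hypothesis exch : forall s x y,
  side x != side y -> side (s x) != side (s y) -> fs s (tperm x y * s)%g.

Definition side_preserving s := forall z, side (s z) = side z.

(** A person of the right side standing on the left can be exchanged with a person
of the left side standing on the right, and these are equally many. *)
Lemma connect_side_preserving s : exists2 t, fs s t & side_preserving t.
Proof.
have [n] := ubnP #|[set z | (side z == true) && (side (s z) == false)]|.
elim: n s => // n IH s; rewrite ltnS.
have := card_opposite_types balanced s true false.
set P := [set z | _ && _]; set N := [set z | _ && _] => PN Pn.
have [P0|[x xP]] := set_0Vmem P.
  exists s => // z; move: PN; rewrite P0 cards0 => /esym/cards0_eq N0.
  have : z \notin P by rewrite P0 inE.
  have : z \notin N by rewrite N0 inE.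
  by rewrite !inE; case: (side z); case: (side (s z)).
have [y yN] : exists y, y \in N.
  apply/set0Pn; rewrite -card_gt0 -PN card_gt0; apply/set0Pn; by exists x.
move: xP yN; rewrite !inE => /andP[/eqP xs /eqP sx] /andP[ys sy].
have {}ys : side y = false by case: (side y) ys.
have {}sy : side (s y) = true by case: (side (s y)) sy.
have [|t tt' tp] := IH (tperm x y * s)%g; last first.
  by exists t => //; apply: connect_trans tt'; apply: exch; rewrite ?xs ?ys ?sx ?sy.
apply: leq_trans Pn; apply: proper_card; apply/properP; split.
  apply/subsetP => z; rewrite !inE permM.
  by case: tpermP => [->|->|//]; rewrite ?xs ?ys ?sx ?sy.
by exists x; rewrite !inE ?permM ?tpermL ?xs ?sx ?sy.
Qed.

(** Four exchanges around the cycle [x1, y1, x2, y2]: first the pairs [x1 y1] and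
[x2 y2], which puts both left persons on the right, then [x1 y2] and [x2 y1]. *)
Lemma double_transposition s x1 x2 y1 y2 : side_preserving s ->
  side x1 -> side x2 -> ~~ side y1 -> ~~ side y2 -> x1 != x2 -> y1 != y2 ->
  fs s (tperm x1 x2 * (tperm y1 y2 * s))%g.
Proof.
move=> sp sx1 sx2 sy1 sy2 x12 y12.
have xy x y : side x -> ~~ side y -> (x != y) * (y != x).
  by move=> sx sy; split; apply: contraNneq sy; [move=> <-|move=> ->].
have ne := (xy _ _ sx1 sy1, xy _ _ sx1 sy2, xy _ _ sx2 sy1, xy _ _ sx2 sy2).
have ne' := (x12, y12, eq_sym x2 x1, eq_sym y2 y1).
have sides := (sp, sx1, sx2, negbTE sy1, negbTE sy2).
have s1 : fs s (tperm x1 y1 * s)%g by apply: exch; rewrite !sides.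
apply: connect_trans s1 _.
have s2 : fs (tperm x1 y1 * s)%g (tperm x2 y2 * (tperm x1 y1 * s))%g.
  by apply: exch; rewrite ?permM ?tpermD ?sides // !(ne, ne').
apply: connect_trans s2 _.
have s3 := @exch (tperm x2 y2 * (tperm x1 y1 * s))%g x1 y2.
apply: connect_trans (s3 _ _) _; first by rewrite !sides.
  rewrite !permM tpermR (tpermD (z := x1)) ?(ne, ne') // tpermL.
  by rewrite (tpermD (z := x2)) ?(ne, ne') // !sides.
have s4 := @exch (tperm x1 y2 * (tperm x2 y2 * (tperm x1 y1 * s)))%g x2 y1.
suff -> : (tperm x1 x2 * (tperm y1 y2 * s) =
  tperm x2 y1 * (tperm x1 y2 * (tperm x2 y2 * (tperm x1 y1 * s))))%g.
  apply: s4; first by rewrite !sides.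
  rewrite !permM (tpermD (x := x1) (y := y2) (z := x2)) ?(ne, ne') // tpermL.
  rewrite (tpermD (z := y2)) ?(ne, ne') // (tpermD (z := y1)) ?(ne, ne') //.
  by rewrite (tpermD (x := x2) (z := y1)) ?(ne, ne') // tpermR !sides.
apply/permP => z; rewrite !permM; congr (s _).
have [->|zx1] := eqVneq z x1.
  rewrite tpermL (tpermD (x := y1)) ?(ne, ne') // (tpermD (x := x2) (z := x1)) ?(ne, ne') //.
  by rewrite tpermL tpermR (tpermD (z := x2)) ?(ne, ne').
have [->|zx2] := eqVneq z x2.
  rewrite tpermR tpermL (tpermD (x := y1)) ?(ne, ne') // (tpermD (x := x1) (z := y1)) ?(ne, ne') //.
  by rewrite (tpermD (x := x2) (z := y1)) ?(ne, ne') // tpermR.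
have [->|zy1] := eqVneq z y1.
  rewrite (tpermD (x := x1) (y := x2)) ?(ne, ne') // tpermL tpermR.
  by rewrite (tpermD (x := x1) (z := x2)) ?(ne, ne') // tpermL (tpermD (z := y2)) ?(ne, ne').
have [->|zy2] := eqVneq z y2.
  rewrite (tpermD (x := x1) (y := x2)) ?(ne, ne') // tpermR.
  rewrite (tpermD (x := x2) (z := y2)) ?(ne, ne') // tpermR.
  by rewrite (tpermD (x := x2) (z := x1)) ?(ne, ne') // tpermL.
by rewrite !tpermD // eq_sym.
Qed.

(** The companion transposition is always [b1 b2]: the right side is sorted
afterwards. *)
Lemma connect_fixing_side s : side_preserving s ->
  exists t, [/\ fs s t, side_preserving t & forall z, side z -> t z = z].
Proof.
have [n] := ubnP #|[set z | side z && (s z != z)]|.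
elim: n s => // n IH s; rewrite ltnS => Pn sp.
have [P0|[x]] := set_0Vmem [set z | side z && (s z != z)].
  exists s; split=> // z sz; apply/eqP; apply/negPn/negP => szz.
  by have := in_set0 z; rewrite -P0 inE sz szz.
rewrite inE => /andP[sx xs].
(* Transposing [x] with the position of the person [x] puts that person home. *)
pose y := (s^-1)%g x; have sy : s y = x by rewrite permKV.
have yx : y != x by apply: contraNneq xs => {1}<-; rewrite sy.
have sdy : side y by rewrite -sp sy.
pose t := (tperm x y * (tperm b1 b2 * s))%g.
have tE z : side z -> t z = s (tperm x y z).
  move=> sz; rewrite !permM (tpermD (x := b1)) //; case: tpermP => [_|_|_ _];
    first [by apply: contraNneq sb1 => ->|by apply: contraNneq sb2 => ->].
have [||t' [tt' tp' t'fix]] := IH t.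
- apply: leq_trans Pn; apply: proper_card; apply/properP; split.
    apply/subsetP => z; rewrite !inE => /andP[sz]; rewrite sz tE //=.
    case: tpermP => [->|->|//]; first by rewrite sy eqxx.
    by rewrite sy (eq_sym x) yx.
  by exists x; rewrite !inE sx //= tE // tpermL sy eqxx.
- move=> z; rewrite !permM sp; case: (tpermP x y z) => [->|->|_ _].
  + by rewrite tpermD ?sdy ?sx //; [apply: contraNneq sb1 => ->|apply: contraNneq sb2 => ->].
  + by rewrite tpermD ?sdy ?sx //; [apply: contraNneq sb1 => ->|apply: contraNneq sb2 => ->].
  + by case: tpermP => [->|->|//]; rewrite (negbTE sb1) (negbTE sb2).
exists t'; split=> //; apply: connect_trans tt'.
by apply: double_transposition => //; rewrite eq_sym.
Qed.

(** Sorting the right side now costs a transposition of [a1] and [a2] per step, so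
the left side alternates between the identity and [tperm a1 a2]. *)
Lemma connect_identity_or_tperm s : fs s 1%g || fs s (tperm a1 a2).
Proof.
have [t st tp] := connect_side_preserving s.
have [{}t' [tt' {}tp tfix]] := connect_fixing_side tp.
have {tt' t st}ss := connect_trans st tt'.
suff /orP[h|h] : fs t' 1%g || fs t' (tperm a1 a2).
- by rewrite (connect_trans ss h).
- by rewrite (connect_trans ss h) orbT.
have {tfix}tE : (forall z, side z -> t' z = z) \/
    (forall z, side z -> t' z = tperm a1 a2 z) by left.
clear ss; move: t' tp tE => {}s sp sE; move: sp sE.
have [n] := ubnP #|[set z | ~~ side z && (s z != z)]|.
elim: n s => // n IH s; rewrite ltnS => Pn sp sE.
have [P0|[x]] := set_0Vmem [set z | ~~ side z && (s z != z)].
  have sfix z : ~~ side z -> s z = z.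
    move=> sz; apply/eqP; apply/negPn/negP => szz.
    by have := in_set0 z; rewrite -P0 inE sz szz.
  apply/orP; case: sE => sE; [left|right].
    suff -> : s = 1%g by [].
    by apply/permP => z; rewrite perm1; case: (boolP (side z)); [exact: sE|exact: sfix].
  suff -> : s = tperm a1 a2 by [].
  apply/permP => z; case: (boolP (side z)) => sz; first exact: sE.
  by rewrite sfix // tpermD //; apply: contraNneq sz => <-.
rewrite inE => /andP[sx xs].
(* Transposing [x] with the position of the person [x] puts that person home. *)
pose y := (s^-1)%g x; have sy : s y = x by rewrite permKV.
have yx : y != x by apply: contraNneq xs => {1}<-; rewrite sy.
have sdy : ~~ side y by rewrite -sp sy.
pose t := (tperm a1 a2 * (tperm x y * s))%g.
have tE z : ~~ side z -> t z = s (tperm x y z).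
  move=> sz; rewrite !permM (tpermD (x := a1)) //.
    by apply: contraNneq sz => <-.
  by apply: contraNneq sz => <-.
have tE' z : side z -> t z = s (tperm a1 a2 z).
  move=> sz; have sz' : side (tperm a1 a2 z) by case: tpermP.
  rewrite !permM (tpermD (x := x)) //.
    by apply: contraNneq sx => ->.
  by apply: contraNneq sdy => ->.
have st : fs s t by apply: double_transposition => //; rewrite eq_sym.
have [|||h|h] := orP (IH t _ _ _).
- apply: leq_trans Pn; apply: proper_card; apply/properP; split.
    apply/subsetP => z; rewrite !inE => /andP[sz]; rewrite sz tE //=.
    case: tpermP => [->|->|//]; first by rewrite sy eqxx.
    by rewrite sy (eq_sym x) yx.
  by exists x; rewrite !inE sx //= tE // tpermL sy eqxx.
- move=> z; case: (boolP (side z)) => sz.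
    by rewrite tE' // sp; case: tpermP.
  by rewrite tE // sp; apply/negbTE; case: tpermP.
- case: sE => sE; [right|left] => z sz; have sz' : side (tperm a1 a2 z) by case: tpermP.
    by rewrite tE' // sE.
  by rewrite tE' // sE // tpermK.
- by rewrite (connect_trans st h).
- by rewrite (connect_trans st h) orbT.
Qed.

Lemma exchange_two_components : num_components (friends_and_strangers X Y) = 2.
Proof.
apply: (n_comp_eq2 (a := 1%g) (b := tperm a1 a2)); first exact: fs_connect_sym.
- apply/negP => /(fs_parity_connect crossX crossY).
  rewrite -[tperm a1 a2]mulg1 fs_parity_tperm //; last by rewrite sa1 sa2.
  by case: fs_parity.
- move=> s; rewrite !(fs_connect_sym _ _ _ s); exact: connect_identity_or_tperm.
Qed.

End TwoComponents.

(** * Random subgraphs as product measures *)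

Section ProductFormula.
Local Open Scope ring_scope.
Variables (R : realType) (T : finType) (G : sgraph T) (p : R).
Implicit Types (H : sgraph T).

Lemma sum_subgraphs_prod (phi : {set T} -> bool -> R) :
  \sum_H rsub_pmf G p H * \prod_(e in edges G) phi e (e \in edges H) =
  \prod_(e in edges G) (p * phi e true + (1 - p) * phi e false).
Proof.
pose psi e (b : bool) := (if b then p else 1 - p) * phi e b.
transitivity (\sum_(H | edges H \subset edges G)
                \prod_(e in edges G) psi e (e \in edges H)).
  rewrite [RHS]big_mkcond; apply: eq_bigr => H _; rewrite /rsub_pmf.
  by case: ifP; rewrite ?mul0r // -big_split.
transitivity (\prod_(e in edges G) \sum_(b : bool) psi e b); last first.
  by apply: eq_bigr => e _; rewrite big_bool.
rewrite (big_distr_big_dep false).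
(* Subgraphs of [G] correspond to the Boolean functions supported on its edges. *)
pose graph_of (f : {ffun {set T} -> bool}) : sgraph T := insubd G [set e | f e].
pose indicator H := [ffun e => e \in edges H].
have graph_ofK H : graph_of (indicator H) = H.
  apply: val_inj; rewrite /graph_of val_insubd.
  have -> : [set e | indicator H e] = edges H by apply/setP => e; rewrite inE ffunE.
  by rewrite edgesP.
have edges_graph_of (f : {ffun {set T} -> bool}) :
    (forall e, f e -> e \in edges G) -> edges (graph_of f) = [set e | f e].
  move=> fG; rewrite /graph_of val_insubd; case: ifP => // /negP[].
  apply/forall_inP => e; rewrite inE => /fG; exact: (forall_inP (edgesP G)).
rewrite (reindex_onto graph_of indicator) /=; last by move=> H _.
apply: eq_big => [f|f /andP[fG /eqP fK]]; last first.
  by apply: eq_bigr => e _; rewrite -[in RHS]fK ffunE.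
apply/andP/pfamilyP => [[fG /eqP fK]|[fG _]].
  split=> //; apply/subsetP => e; rewrite inE -fK ffunE eqbF_neg negbK.
  exact: (subsetP fG).
have fE e : f e -> e \in edges G.
  by move=> fe; apply: (subsetP fG); rewrite inE eqbF_neg negbK.
rewrite edges_graph_of //; split; first by apply/subsetP => e; rewrite inE => /fE.
by apply/eqP/ffunP => e; rewrite ffunE edges_graph_of // inE.
Qed.

(** Independence in the form used below: the expectation of a product of functions
of distinct edges is the product of their expectations. *)
Lemma sum_subgraphs_prod_inj (K : finType) (edge : K -> {set T}) (phi : K -> bool -> R) :
  injective edge -> (forall k, edge k \in edges G) ->
  \sum_H rsub_pmf G p H * \prod_k phi k (edge k \in edges H) =
  \prod_k (p * phi k true + (1 - p) * phi k false).
Proof.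
move=> edgeI edgeG.
pose psi e b := if [pick k | edge k == e] is Some k then phi k b else 1.
have psiE k b : psi (edge k) b = phi k b.
  by rewrite /psi; case: pickP => [k' /eqP /edgeI -> //|/(_ k)]; rewrite eqxx.
have prodE (F : {set T} -> R) : (forall e, e \notin codom edge -> F e = 1) ->
    \prod_(e in edges G) F e = \prod_k F (edge k).
  move=> F1; rewrite (bigID (mem (codom edge))) /= [X in _ * X]big1 ?mulr1.
    rewrite -(big_imset _ (in2W edgeI)) /=; apply: eq_bigl => e.
    apply/andP/imsetP => [[_ /codomP[k ->]]|[k _ ->]]; first by exists k.
    by split; rewrite ?codom_f.
  by move=> e /andP[_ /F1].
have psi1 e b : e \notin codom edge -> psi e b = 1.
  move=> eN; rewrite /psi; case: pickP => // k /eqP ke.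
  by rewrite -ke codom_f in eN.
transitivity (\sum_H rsub_pmf G p H * \prod_(e in edges G) psi e (e \in edges H)).
  apply: eq_bigr => H _; rewrite prodE; last by move=> e /psi1.
  by congr (_ * _); apply: eq_bigr => k _; rewrite psiE.
rewrite sum_subgraphs_prod prodE.
  by apply: eq_bigr => k _; rewrite !psiE.
by move=> e eN; rewrite !psi1 // !mulr1 addrC subrK.
Qed.

Lemma sum_rsub_pmf : \sum_H rsub_pmf G p H = 1.
Proof.
have := sum_subgraphs_prod (fun _ _ => 1); rewrite [RHS]big1 => [<-|e _].
  by apply: eq_bigr => H _; rewrite big1 // mulr1.
by rewrite !mulr1 addrC subrK.
Qed.

Lemma sum_pairs_fst (F : sgraph T -> R) :
  \sum_X \sum_Y rsub_pmf G p X * rsub_pmf G p Y * F X = \sum_X rsub_pmf G p X * F X.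
Proof.
apply: eq_bigr => X _; under eq_bigr => Y _ do rewrite mulrAC.
by rewrite -big_distrr /= sum_rsub_pmf mulr1.
Qed.

Lemma sum_pairs_snd (F : sgraph T -> R) :
  \sum_X \sum_Y rsub_pmf G p X * rsub_pmf G p Y * F Y = \sum_Y rsub_pmf G p Y * F Y.
Proof.
rewrite exchange_big -sum_pairs_fst; apply: eq_bigr => Y _; apply: eq_bigr => X _.
by rewrite [rsub_pmf G p X * _]mulrC.
Qed.

Hypothesis p01 : 0 <= p <= 1.

Lemma rsub_pmf_ge0 H : 0 <= rsub_pmf G p H.
Proof.
rewrite /rsub_pmf; case: ifP => // _; apply: prodr_ge0 => e _.
by case/andP: p01 => p0 p1; case: ifP; rewrite ?subr_ge0.
Qed.

(** The union bound: [F] dominates the indicator of failure. *)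
Lemma rsub2_prob_ge (A : sgraph T -> sgraph T -> bool) (F : sgraph T -> sgraph T -> R) :
  (forall X Y, 0 <= F X Y) ->
  (forall X Y, edges X \subset edges G -> edges Y \subset edges G ->
     ~~ A X Y -> 1 <= F X Y) ->
  1 - \sum_X \sum_Y rsub_pmf G p X * rsub_pmf G p Y * F X Y <= rsub2_prob G p A.
Proof.
move=> F0 F1; rewrite lerBlDr.
have -> : (1 : R) = \sum_X \sum_Y rsub_pmf G p X * rsub_pmf G p Y.
  rewrite -[LHS]sum_rsub_pmf; apply: eq_bigr => X _.
  by rewrite -big_distrr /= sum_rsub_pmf mulr1.
rewrite /rsub2_prob !pair_big /= [X in _ <= X + _]big_mkcond -big_split /=; apply: ler_sum => -[X Y] _ /=.
have [pX pY] := (rsub_pmf_ge0 X, rsub_pmf_ge0 Y).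
case: (boolP (A X Y)) => AXY; first by rewrite lerDl !mulr_ge0.
rewrite add0r; case: (boolP (edges X \subset edges G)) => XG; last first.
  by rewrite /rsub_pmf (negbTE XG) !mul0r.
case: (boolP (edges Y \subset edges G)) => YG; last first.
  by rewrite /rsub_pmf (negbTE YG) !(mulr0, mul0r).
by rewrite ler_peMr ?mulr_ge0 // F1.
Qed.

Lemma rsub2_prob_le1 (A : sgraph T -> sgraph T -> bool) : rsub2_prob G p A <= 1.
Proof.
have -> : (1 : R) = \sum_X \sum_Y rsub_pmf G p X * rsub_pmf G p Y.
  rewrite -[LHS]sum_rsub_pmf; apply: eq_bigr => X _.
  by rewrite -big_distrr /= sum_rsub_pmf mulr1.
rewrite /rsub2_prob !pair_big /= [X in X <= _]big_mkcond; apply: ler_sum => -[X Y] _ /=.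
by case: ifP => // _; rewrite mulr_ge0 ?rsub_pmf_ge0.
Qed.

End ProductFormula.

(** * Degrees and mixing in random bipartite graphs *)

Section RandomBipartite.
Local Open Scope ring_scope.
Variables (R : realType) (r : nat) (p : R).
Hypothesis p01 : 0 <= p <= 1.
Local Notation V := ('I_r + 'I_r)%type.
Implicit Types (X Y H : sgraph V).

Definition left_side (z : V) : bool := if z is inl _ then true else false.

Definition opposite (a : V) (i : 'I_r) : V := if a is inl _ then inr i else inl i.

Lemma opposite_inj a : injective (opposite a).
Proof. by case: a => a i j []. Qed.

Lemma mem_Krr_edges a b : ([set a; b] \in edges (Krr r)) = (left_side a != left_side b).
Proof.
apply/imsetP/idP => [[[i j] _ /= abE]|].
  have : left_side (inl i : V) != left_side (inr j : V) by [].
  have : inl i \in [set a; b] by rewrite abE !inE eqxx.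
  have : inr j \in [set a; b] by rewrite abE !inE eqxx orbT.
  rewrite !inE => /orP[]/eqP -> /orP[]/eqP -> //; first by rewrite eqxx.
    by rewrite eq_sym.
  by rewrite eqxx.
case: a b => [i|i] [j|j] //= _; first by exists (i, j).
by exists (j, i) => //; rewrite setUC.
Qed.

Lemma subgraph_crossing H : edges H \subset edges (Krr r) -> crossing left_side H.
Proof. by move=> /subsetP HK a b /HK; rewrite mem_Krr_edges. Qed.

Lemma left_side_balanced : #|[set z | left_side z]| = #|[set z | ~~ left_side z]|.
Proof.
transitivity r.
  rewrite -[RHS]card_ord -[RHS](card_imset _ (@inl_inj _ 'I_r)); apply: eq_card => z.
  by rewrite !inE; apply/idP/imsetP => [|[i _ ->]//]; case: z => // i _; exists i.
rewrite -[LHS]card_ord -[LHS](card_imset _ (@inr_inj 'I_r _)); apply: eq_card => z.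
by rewrite !inE; apply/imsetP/idP => [[i _ ->]//|]; case: z => // i _; exists i.
Qed.

Lemma card_neighbors H a : edges H \subset edges (Krr r) ->
  #|neighbors H a| = (\sum_i ([set a; opposite a i] \in edges H))%N.
Proof.
move=> /subsetP HK.
have -> : neighbors H a = opposite a @: [set i | adj H a (opposite a i)].
  apply/setP => b; rewrite inE; apply/idP/imsetP => [ab|[i + ->]]; last by rewrite inE.
  have := HK _ ab; rewrite mem_Krr_edges => ab'.
  suff [i bE] : exists i, b = opposite a i by exists i; rewrite // inE -bE.
  by case: a b ab' {ab} => [i|i] [j|j] //= _; exists j.
rewrite card_imset; last exact: opposite_inj.
by rewrite -sum1_card big_mkcond /=; apply: eq_bigr => i _; rewrite inE /adj /=; case: (_ \in _).
Qed.

Lemma sum_expr_degree (c : R) a :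
  \sum_H rsub_pmf (Krr r) p H * c ^+ #|neighbors H a| = (1 + p * (c - 1)) ^+ r.
Proof.
transitivity (\sum_H rsub_pmf (Krr r) p H *
    \prod_i c ^+ ([set a; opposite a i] \in edges H)).
  apply: eq_bigr => H _; rewrite /rsub_pmf; case: ifP => [HK|_]; last by rewrite !mul0r.
  by rewrite card_neighbors // prodrXr.
rewrite (sum_subgraphs_prod_inj p (fun _ (b : bool) => c ^+ b)).
- rewrite prodr_const card_ord; congr (_ ^+ _).
  by rewrite expr1 expr0 mulr1 mulrBr mulr1 addrCA addrC.
- move=> i j ij; apply: (@opposite_inj a).
  have : opposite a i \in [set a; opposite a j] by rewrite -ij !inE eqxx orbT.
  by rewrite !inE => /orP[/eqP|/eqP //]; case: a {ij}.
- by move=> i; rewrite mem_Krr_edges; case: a.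
Qed.

(** For fixed families the [m * m] pairs of edges are pairwise disjoint in either
graph, so each pair is present independently with probability [p ^+ 2]. *)
Lemma sum_missing_pairs (m : nat) (c b f g : 'I_m -> V) :
  injective c -> injective b -> injective f -> injective g ->
  (forall i j, left_side (c i) != left_side (b j)) ->
  (forall i j, left_side (f i) != left_side (g j)) ->
  \sum_X \sum_Y rsub_pmf (Krr r) p X * rsub_pmf (Krr r) p Y *
     \prod_(ij : 'I_m * 'I_m)
       (1 - (adj X (c ij.1) (b ij.2))%:R * (adj Y (f ij.1) (g ij.2))%:R)
  = (1 - p ^+ 2) ^+ (m * m).
Proof.
have edgeI (u v : 'I_m -> V) : injective u -> injective v ->
    (forall i j, left_side (u i) != left_side (v j)) ->
    injective (fun ij : 'I_m * 'I_m => [set u ij.1; v ij.2]).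
  move=> uI vI uv [i j] [i' j'] /= /setP e.
  have := e (u i); rewrite !inE eqxx => /esym/orP[/eqP/uI ->|/eqP uv']; last first.
    by have := uv i j'; rewrite uv' eqxx.
  have := e (v j); rewrite !inE eqxx orbT => /esym/orP[/eqP vu|/eqP/vI -> //].
  by have := uv i' j; rewrite vu eqxx.
move=> cI bI fI gI cb fg.
transitivity (\sum_X rsub_pmf (Krr r) p X *
    \prod_(ij : 'I_m * 'I_m) (1 - p * ([set c ij.1; b ij.2] \in edges X)%:R)).
  apply: eq_bigr => X _; under eq_bigr => Y _ do rewrite -mulrA.
  rewrite -big_distrr /=; congr (_ * _).
  rewrite (sum_subgraphs_prod_inj p (edge := fun ij : 'I_m * 'I_m => [set f ij.1; g ij.2])
    (fun ij (y : bool) => 1 - (adj X (c ij.1) (b ij.2))%:R * y%:R)).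
  - by apply: eq_bigr => ij _; rewrite /adj /= mulr0n mulr1n; ring.
  - exact: edgeI.
  - by move=> ij; rewrite mem_Krr_edges.
rewrite (sum_subgraphs_prod_inj p (edge := fun ij : 'I_m * 'I_m => [set c ij.1; b ij.2])
    (fun ij (x : bool) => 1 - p * x%:R)).
- rewrite prodr_const card_prod card_ord; congr (_ ^+ _).
  by rewrite mulr0n mulr1n; ring.
- exact: edgeI.
- by move=> ij; rewrite mem_Krr_edges.
Qed.

(** With [d = c ^- k] this dominates the indicator of a vertex of degree at least
[k] when [1 <= c], and of degree at most [k] when [c <= 1]. *)
Definition degree_weight (d c : R) H : R := \sum_a d * c ^+ #|neighbors H a|.

Lemma sum_degree_weight (d c : R) :
  \sum_H rsub_pmf (Krr r) p H * degree_weight d c H =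
  (2 * r)%:R * (d * (1 + p * (c - 1)) ^+ r).
Proof.
under eq_bigr => H _ do rewrite /degree_weight big_distrr /=.
rewrite exchange_big /=.
under eq_bigr => a _.
  under eq_bigr => H _ do rewrite mulrCA.
  rewrite -big_distrr /= sum_expr_degree; over.
by rewrite sumr_const card_sum card_ord mulr_natl addnn mul2n.
Qed.

Lemma degree_weight_ge0 (d c : R) H : 0 <= d -> 0 <= c -> 0 <= degree_weight d c H.
Proof. by move=> d0 c0; apply: sumr_ge0 => a _; rewrite mulr_ge0 ?exprn_ge0. Qed.

Lemma degree_weight_ge1 (d c : R) H a : 0 <= d -> 0 <= c ->
  1 <= d * c ^+ #|neighbors H a| -> 1 <= degree_weight d c H.
Proof.
move=> d0 c0 ac; rewrite /degree_weight (bigD1 a) //= ler_wpDr //.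
by apply: sumr_ge0 => b _; rewrite mulr_ge0 ?exprn_ge0.
Qed.

Lemma sum_degree_weights (d c : R) :
  \sum_X \sum_Y rsub_pmf (Krr r) p X * rsub_pmf (Krr r) p Y *
      (degree_weight d c X + degree_weight d c Y) =
  (4 * r)%:R * (d * (1 + p * (c - 1)) ^+ r).
Proof.
under eq_bigr => X _ do (under eq_bigr => Y _ do rewrite mulrDr; rewrite big_split).
rewrite big_split /= sum_pairs_fst sum_pairs_snd sum_degree_weight -mulrDl -natrD.
by rewrite -mulnDl.
Qed.

Lemma max_degree_prob (A : sgraph V -> sgraph V -> bool) (c : R) (k : nat) :
  1 <= c ->
  (forall X Y, edges X \subset edges (Krr r) -> edges Y \subset edges (Krr r) ->
    (forall a, #|neighbors X a| < k)%N -> (forall a, #|neighbors Y a| < k)%N -> A X Y) ->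
  1 - (4 * r)%:R * (c ^- k * (1 + p * (c - 1)) ^+ r) <= rsub2_prob (Krr r) p A.
Proof.
move=> c1 AP; have c0 : 0 < c by apply: lt_le_trans c1.
have d0 : 0 <= c ^- k by rewrite invr_ge0 exprn_ge0 // ltW.
have w1 H a : (k <= #|neighbors H a|)%N -> 1 <= degree_weight (c ^- k) c H.
  move=> ka; apply: (degree_weight_ge1 (a := a)) => //; first exact: ltW.
  by rewrite mulrC ler_pdivlMr ?exprn_gt0 // mul1r ler_weXn2l.
rewrite -sum_degree_weights; apply: rsub2_prob_ge => //.
- by move=> X Y; rewrite addr_ge0 // degree_weight_ge0 // ltW.
- move=> X Y XK YK /negP NA.
  have w0 H : 0 <= degree_weight (c ^- k) c H by rewrite degree_weight_ge0 // ltW.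
  have [/existsP[a ka]|/existsPn Xk] := boolP [exists a, (k <= #|neighbors X a|)%N].
    by rewrite ler_wpDr ?w0 // (w1 _ a).
  have [/existsP[a ka]|/existsPn Yk] := boolP [exists a, (k <= #|neighbors Y a|)%N].
    by rewrite ler_wpDl ?w0 // (w1 _ a).
  by case: NA; apply: AP => // a; rewrite ltnNge.
Qed.

Definition opposed_families (m : nat) (cbfg : {ffun 'I_m -> V} * {ffun 'I_m -> V} *
    ({ffun 'I_m -> V} * {ffun 'I_m -> V})) : bool :=
  let: ((c, b), (f, g)) := cbfg in
  [&& injectiveb c, injectiveb b, injectiveb f, injectiveb g,
      [forall i, forall j, left_side (c i) != left_side (b j)] &
      [forall i, forall j, left_side (f i) != left_side (g j)]].

(** The number of opposed families that violate [mixing]: the product over [ij] is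
the indicator that no pair is joined in both graphs. *)
Definition missing_weight (m : nat) X Y : R :=
  \sum_(cbfg | @opposed_families m cbfg) \prod_(ij : 'I_m * 'I_m)
     (1 - (adj X (cbfg.1.1 ij.1) (cbfg.1.2 ij.2))%:R *
          (adj Y (cbfg.2.1 ij.1) (cbfg.2.2 ij.2))%:R).

Lemma missing_weight_ge0 (m : nat) X Y : 0 <= missing_weight m X Y.
Proof.
apply: sumr_ge0 => cbfg _; apply: prodr_ge0 => ij _.
by case: adj; case: adj; rewrite ?mulr1 ?mulr0 ?subr0 ?subrr.
Qed.

Lemma missing_weight_ge1 (m : nat) X Y :
  ~~ mixing left_side m X Y -> 1 <= missing_weight m X Y.
Proof.
rewrite !negb_forall => /existsP[c]; rewrite negb_forall => /existsP[b].
rewrite negb_forall => /existsP[f]; rewrite negb_forall => /existsP[g].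
rewrite negb_imply negb_exists => /andP[opp /forallP noij].
rewrite /missing_weight (bigD1 ((c, b), (f, g))) //= big1 => [|[i j] _ /=].
  rewrite lerDl; apply: sumr_ge0 => cbfg _; apply: prodr_ge0 => ij _.
  by case: adj; case: adj; rewrite ?mulr1 ?mulr0 ?subr0 ?subrr.
have := noij i; rewrite negb_exists => /forallP /(_ j).
by case: adj; case: adj; rewrite //= ?mulr0 ?mul0r ?subr0.
Qed.

Lemma sum_missing_weight (m : nat) :
  \sum_X \sum_Y rsub_pmf (Krr r) p X * rsub_pmf (Krr r) p Y * missing_weight m X Y <=
  (2 * r)%:R ^+ (4 * m) * (1 - p ^+ 2) ^+ (m * m).
Proof.
under eq_bigr => X _.
  under eq_bigr => Y _ do rewrite /missing_weight big_distrr.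
  rewrite exchange_big; over.
rewrite exchange_big /=.
rewrite (eq_bigr (fun=> (1 - p ^+ 2) ^+ (m * m))); last first.
  move=> [[c b] [f g]] /and5P[/injectiveP cI /injectiveP bI /injectiveP fI /injectiveP gI].
  move=> /andP[/forallP cb /forallP fg]; apply: sum_missing_pairs => // i j.
    exact: (forallP (cb i)).
  exact: (forallP (fg i)).
have p2 : 0 <= 1 - p ^+ 2.
  by case/andP: p01 => p0 p1; rewrite subr_ge0 exprn_ile1.
rewrite sumr_const -[leLHS]mulr_natl; apply: ler_wpM2r; rewrite ?exprn_ge0 // -natrX ler_nat.
apply: leq_trans (max_card _) _; rewrite !card_prod !card_ffun card_sum !card_ord.
by rewrite addnn -mul2n -!expnD leq_eqVlt; apply/orP; left; apply/eqP; congr expn; lia.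
Qed.

Lemma min_degree_mixing_prob (A : sgraph V -> sgraph V -> bool) (q m : nat) :
  (forall X Y, edges X \subset edges (Krr r) -> edges Y \subset edges (Krr r) ->
    (forall a, q <= #|neighbors X a|)%N -> (forall a, q <= #|neighbors Y a|)%N ->
    mixing left_side m X Y -> A X Y) ->
  1 - ((4 * r)%:R * (2 ^+ q * (1 - p / 2) ^+ r) +
       (2 * r)%:R ^+ (4 * m) * (1 - p ^+ 2) ^+ (m * m)) <= rsub2_prob (Krr r) p A.
Proof.
move=> AP.
have d0 : 0 <= 2 ^+ q :> R by rewrite exprn_ge0.
have c0 : 0 <= 2^-1 :> R by rewrite invr_ge0.
have w0 H : 0 <= degree_weight (2 ^+ q) 2^-1 H by exact: degree_weight_ge0.
have w1 H a : (#|neighbors H a| < q)%N -> 1 <= degree_weight (2 ^+ q) 2^-1 H.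
  move=> ka; apply: (degree_weight_ge1 (a := a)) => //.
  by rewrite exprVn ler_pdivlMr ?exprn_gt0 // mul1r ler_weXn2l ?ler1n // ltnW.
have -> : 1 - p / 2 = 1 + p * (2^-1 - 1) by field.
apply: le_trans (rsub2_prob_ge p01 (F := fun X Y => degree_weight (2 ^+ q) 2^-1 X +
   degree_weight (2 ^+ q) 2^-1 Y + missing_weight m X Y) _ _).
- rewrite lerD2l lerN2.
  under eq_bigr => X _ do (under eq_bigr => Y _ do rewrite mulrDr; rewrite big_split).
  by rewrite big_split /= sum_degree_weights lerD2l sum_missing_weight.
- by move=> X Y; rewrite !addr_ge0 // missing_weight_ge0.
- move=> X Y XK YK /negP NA; have z0 := missing_weight_ge0 m X Y.
  have [/existsP[a ka]|/existsPn Xk] := boolP [exists a, (#|neighbors X a| < q)%N].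
    by rewrite -addrA ler_wpDr ?addr_ge0 // (w1 _ a).
  have [/existsP[a ka]|/existsPn Yk] := boolP [exists a, (#|neighbors Y a| < q)%N].
    by rewrite ler_wpDr // ler_wpDl // (w1 _ a).
  have [mix|/missing_weight_ge1 z1] := boolP (mixing left_side m X Y).
    by case: NA; apply: AP => // a; rewrite leqNgt.
  by rewrite ler_wpDl // addr_ge0.
Qed.

End RandomBipartite.

(** * Asymptotics *)

Section HighProbability.
Local Open Scope ring_scope.
Variable R : realType.
Implicit Types (p e : R) (r : nat).

Lemma whp_lower_bound (pr : nat -> R) (K : R) : 0 <= K ->
  (forall r, pr r <= 1) -> (\forall r \near \oo%classic, 1 - K / r%:R <= pr r) -> whp pr.
Proof.
move=> K0 pr1 prK.
apply: (@squeeze_cvgr _ _ _ _ (fun r => 1 - 2 * K * harmonic r) (fun=> 1)).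
- near=> r; rewrite pr1 andbT.
  have r0 : (0 < r)%N by near: r; exact: nbhs_infty_gt.
  apply: le_trans (near prK r _) => //; rewrite lerD2l lerN2 /harmonic /=.
  rewrite ler_pdivrMr ?ltr0n // mulrAC ler_pdivlMr ?ltr0n // -natr1.
  have : 1 <= r%:R :> R by rewrite ler1n.
  by nra.
- rewrite -[X in (_ --> X)%classic]subr0; apply: cvgB; first exact: cvg_cst.
  rewrite -[X in (_ --> X)%classic](mulr0 (2 * K)); apply: cvgMr; exact: cvg_harmonic.
- exact: cvg_cst.
Unshelve. all: by end_near.
Qed.

Lemma expr_1D_le (x : R) n : 0 <= 1 + x -> (1 + x) ^+ n <= expR (x * n%:R).
Proof. by move=> x1; rewrite expRM_natr lerXn2r ?nnegrE ?expR_ge0 // expR_ge1Dx. Qed.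

(** The rate in the bound [expR (- d * sqrt r)] for the probability that a given
degree reaches [sqrt r], from the moment of base [expR (e / 2)]. *)
Definition exponent_gap e : R := e / 2 - (1 - e) * (expR (e / 2) - 1).

Lemma sparse_prob p e r : 0 < e -> e < 1 -> 0 <= p <= 1 -> (1 < r)%N ->
  p <= (1 - e) / Num.sqrt r%:R ->
  1 - (96 / exponent_gap e ^+ 4) / r%:R <=
  rsub2_prob (Krr r) p
    (fun X Y => (2 < num_components (friends_and_strangers X Y))%N).
Proof.
move=> e0 e1 p01 r1 pr; have /andP[p0 p1] := p01.
set d := exponent_gap e.
set S := Num.sqrt (r%:R : R).
have r0 : 0 < r%:R :> R by rewrite ltr0n ltnW.
have S0 : 0 < S by rewrite sqrtr_gt0.
have S2 : S ^+ 2 = r%:R by rewrite sqr_sqrtr // ltW.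
have d0 : 0 < d.
  have h : 1 - e / 2 <= expR (- (e / 2)) by exact: expR_ge1Dx.
  have E0 : 0 < expR (e / 2) by exact: expR_gt0.
  have : expR (e / 2) * (1 - e / 2) <= 1.
    by rewrite mulrC -ler_pdivlMr // div1r -expRN.
  have : 0 < e * (expR (e / 2) - 1).
    by rewrite mulr_gt0 // subr_gt0 -expR0 ltr_expR divr_gt0.
  by rewrite /d /exponent_gap; set E := expR (e / 2); nra.
(* With [k0] least, degrees below [k0] are at most [k0.-1], whose square is below [r]. *)
have [k0 rk kmin] := ex_minnP (ex_intro (fun k => r <= k * k)%N r (leq_pmulr r (ltnW r1))).
have k0' : (0 < k0)%N by case: (k0) rk => //; lia.
have km : (k0.-1 * k0.-1 < r)%N.
  by rewrite ltnNge; apply/negP => /kmin; lia.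
have Sk : S <= k0%:R.
  by rewrite -[leRHS]ger0_norm // -sqrtr_sqr ler_wsqrtr // -natrX ler_nat -mulnn.
apply: le_trans (max_degree_prob p01 (c := expR (e / 2)) (k := k0) _ _); last first.
- move=> X Y XK YK dX dY.
  have a12 : (Ordinal (ltnW r1) : 'I_r) != Ordinal r1 by [].
  apply: (max_degree_components (side := @left_side r) (d := k0.-1)
    (a1 := inl (Ordinal (ltnW r1))) (a2 := inl (Ordinal r1))
    (b1 := inr (Ordinal (ltnW r1))) (b2 := inr (Ordinal r1))) => //.
  + exact: subgraph_crossing.
  + exact: subgraph_crossing.
  + by move=> a; rewrite -ltnS prednK //; exact: dX.
  + by move=> a; rewrite -ltnS prednK //; exact: dY.
  + by rewrite card_sum card_ord addnn -mul2n ltn_mul2l km.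
- by rewrite -expR0 ler_expR divr_ge0 // ltW.
rewrite lerD2l lerN2.
have le1 : (1 + p * (expR (e / 2) - 1)) ^+ r <= expR ((1 - e) * (expR (e / 2) - 1) * S).
  have E1 : 0 <= expR (e / 2) - 1 by rewrite subr_ge0 -expR0 ler_expR divr_ge0 // ltW.
  apply: le_trans (expr_1D_le _ _) _; first by rewrite addr_ge0 // mulr_ge0.
  rewrite ler_expR -S2 mulrAC [leRHS]mulrAC ler_wpM2r //.
  by rewrite expr2 mulrA ler_wpM2r ?(ltW S0) // -ler_pdivlMr.
have le2 : expR (e / 2) ^- k0 <= expR (- (e / 2 * S)).
  rewrite expRN lef_pV2 ?posrE ?exprn_gt0 ?expR_gt0 // -expRM_natr ler_expR.
  by rewrite ler_wpM2l // divr_ge0 // ltW.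
have le3 : expR (- (d * S)) <= 24 / (d * S) ^+ 4.
  have := @expR_ge1Dxn R (d * S) 3 (ltW (mulr_gt0 d0 S0)).
  rewrite (_ : 4`!%:R = 24) // expRN ler_pdivlMr ?exprn_gt0 ?mulr_gt0 //.
  by rewrite ler_pdivrMl ?expR_gt0 //; lra.
apply: (@le_trans _ _ ((4 * r)%:R * (24 / (d * S) ^+ 4))).
  rewrite ler_wpM2l //; apply: le_trans le3.
  apply: (@le_trans _ _ (expR (- (e / 2 * S)) * expR ((1 - e) * (expR (e / 2) - 1) * S))).
    by apply: ler_pM; rewrite ?invr_ge0 ?exprn_ge0 ?expR_ge0 // addr_ge0 // mulr_ge0 //
      subr_ge0 -expR0 ler_expR divr_ge0 // ltW.
  by rewrite -expRD ler_expR /d /exponent_gap; set E := expR _; lra.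
rewrite natrM exprMn (_ : S ^+ 4 = r%:R ^+ 2); last by rewrite -S2 -exprM.
rewrite le_eqVlt; apply/orP; left; apply/eqP; field.
by rewrite !lt0r_neq0.
Qed.

Lemma expR1_le4 : expR 1 <= 4 :> R.
Proof.
have h : 1 - 2^-1 <= expR (- 2^-1) :> R by exact: expR_ge1Dx.
have E0 : 0 < expR 2^-1 :> R by exact: expR_gt0.
have E2 : expR 2^-1 <= 2 :> R.
  by rewrite -[leRHS]invrK -[leLHS]invrK lef_pV2 ?posrE ?invr_gt0 // -expRN; lra.
have -> : 1 = 2^-1 * 2%:R :> R by lra.
by rewrite expRM_natr expr2; nra.
Qed.

(** With [L = ln (2 r)] and [m] about [6 L / p ^ 2], mixing fails with probability at
most [expR (4 m L - m ^ 2 p ^ 2) <= expR (- 2 L)], and as [m p ^ 2 <= 7 L] the assumption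
on [r p ^ 3] makes [r p / 2] exceed the required degree [29 m + 4] by [2 L]. *)
Lemma dense_prob p r : 0 < p -> p <= 1 -> (2 < r)%N ->
  418 * ln ((2 * r)%:R : R) <= r%:R * p ^+ 3 ->
  1 - 2 / r%:R <=
  rsub2_prob (Krr r) p
    (fun X Y => num_components (friends_and_strangers X Y) == 2%N).
Proof.
move=> p0 p1 r2 Lp; have p01 : 0 <= p <= 1 by rewrite ltW.
have r_gt0 : (0 < r)%N by exact: ltnW (ltnW r2).
have r0 : 0 < r%:R :> R by rewrite ltr0n.
have rr0 : 0 < (2 * r)%:R :> R by rewrite ltr0n; lia.
set L := ln _ in Lp.
have LE : expR L = (2 * r)%:R by rewrite lnK // posrE.
have L1 : 1 <= L.
  rewrite -ler_expR LE; apply: (@le_trans _ _ 4); last by rewrite ler_nat; lia.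
  exact: expR1_le4.
(* The factor 6 leaves [expR (- 2 L)] after the union bound over [4 m] vertices. *)
pose m := (Num.truncn (6 * L / p ^+ 2)).+1.
have p2 : 0 < p ^+ 2 by rewrite exprn_gt0.
have mlow : 6 * L <= m%:R * p ^+ 2 by rewrite -ler_pdivrMr // ltW // truncnS_gt.
have mupp : m%:R * p ^+ 2 <= 7 * L.
  have q0 : 0 <= 6 * L / p ^+ 2 by rewrite divr_ge0 ?mulr_ge0 ?ltW //; lra.
  have := truncn_itv q0; rewrite ler_pdivlMr // => /andP[h _].
  rewrite /m -addn1 natrD mulrDl mul1r.
  have : p ^+ 2 <= 1 by rewrite exprn_ile1 // ltW.
  by lra.
have m1 : 1 <= m%:R :> R by rewrite ler1n.
apply: le_trans (min_degree_mixing_prob p01 (q := (29 * m + 4)%N) (m := m) _); last first.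
- move=> X Y XK YK dX dY mix; apply/eqP.
  have cX := subgraph_crossing XK; have cY := subgraph_crossing YK.
  have r1 : (1 < r)%N by exact: ltnW.
  have a12 : (Ordinal (ltnW r1) : 'I_r) != Ordinal r1 by [].
  apply: (exchange_two_components (side := @left_side r)
    (a1 := inl (Ordinal (ltnW r1))) (a2 := inl (Ordinal r1))
    (b1 := inr (Ordinal (ltnW r1))) (b2 := inr (Ordinal r1))) => //.
    exact: left_side_balanced.
  move=> s x y; apply: (exchange cX cY _ mix) => //; exact: left_side_balanced.
rewrite lerD2l lerN2.
have split2 : 2 / r%:R = r%:R^-1 + r%:R^-1 :> R by rewrite -mulr2n mulr_natl.
rewrite split2; apply: lerD.
- have deg : expR ((29 * m + 4)%:R) * expR (- (p / 2) * r%:R) <= expR (- (2 * L)).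
    rewrite -expRD ler_expR natrD natrM.
    have : 209 * L <= r%:R * p / 2 * p ^+ 2 by move: Lp; rewrite !exprS expr0; lra.
    have : (29 * m%:R + 4 + 2 * L) * p ^+ 2 <= 209 * L.
      have : p ^+ 2 <= 1 by rewrite exprn_ile1 // ltW.
      by nra.
    move=> h1 h2; have := le_trans h1 h2; rewrite ler_pM2r //; lra.
  apply: (@le_trans _ _ ((4 * r)%:R * expR (- (2 * L)))).
    rewrite ler_wpM2l //; apply: le_trans deg; apply: ler_pM.
    + by rewrite exprn_ge0.
    + by rewrite exprn_ge0 // subr_ge0; lra.
    + rewrite -[X in expR X]mul1r expRM_natr lerXn2r ?nnegrE ?expR_ge0 //.
      by apply: le_trans (expR_ge1Dx 1); lra.
    + by rewrite -mulNr; apply: expr_1D_le; lra.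
  rewrite expRN mulrC [2 * L]mulrC expRM_natr LE -natrX.
  rewrite ler_pdivrMl ?ltr0n ?expn_gt0 ?muln_gt0 ?r_gt0 // ler_pdivlMr // -!natrM ler_nat.
  by rewrite expnMn -mulnA leq_mul2l mulnn leqnn orbT.
- apply: (@le_trans _ _ (expR (- (2 * L)))).
    apply: (@le_trans _ _ (expR (L * (4 * m)%:R) * expR (- p ^+ 2 * (m * m)%:R))).
      apply: ler_pM.
      + by rewrite exprn_ge0.
      + by rewrite exprn_ge0 // subr_ge0 exprn_ile1 // ltW.
      + by rewrite expRM_natr LE.
      + by apply: expr_1D_le; rewrite subr_ge0 exprn_ile1 // ltW.
    rewrite -expRD ler_expR !natrM.
    have := ler_wpM2l (ler0n R m) mlow.
    have : 0 <= (m%:R - 1) * L by rewrite mulr_ge0 ?subr_ge0 // (le_trans ler01).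
    by lra.
  rewrite expRN [2 * L]mulrC expRM_natr LE -natrX lef_pV2 ?posrE ?ltr0n ?expn_gt0 ?muln_gt0 ?r_gt0 //.
  by rewrite ler_nat -mulnn mulnA leq_pmull // !muln_gt0 r_gt0.
Qed.

(** Writing [l = ln r], the right-hand side is at least [125 * expR (l / 10)], which
exceeds any multiple of [l]; 2700 is a value of [l] from which the quadratic term of
the exponential suffices. *)
Lemma dense_threshold r p : 2700 <= ln (r%:R : R) ->
  5 * (ln (r%:R : R) `^ (1 / 10)) / (r%:R `^ (3 / 10)) <= p ->
  0 < p /\ 418 * ln ((2 * r)%:R : R) <= r%:R * p ^+ 3.
Proof.
set l := ln _ => l27 lp.
have r0 : 0 < r%:R :> R.
  by rewrite ltNge; apply/negP => /ln0 l0; move: l27; rewrite /l l0; lra.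
have rE : r%:R = expR l by rewrite lnK // posrE.
have lp1 : 1 <= l `^ (1 / 10).
  by rewrite -[leLHS](powRr0 l) ler_powR //; lra.
have pE : (r%:R `^ (3 / 10) : R) = expR (3 / 10 * l) by rewrite /powR gt_eqF.
have E0 : 0 < expR (3 / 10 * l) by exact: expR_gt0.
have p5 : 5 / expR (3 / 10 * l) <= p.
  apply: le_trans lp; by rewrite pE ler_pM2r ?invr_gt0 // ler_peMr.
have p0 : 0 < p by apply: lt_le_trans p5; rewrite divr_gt0.
split=> //.
have p3 : (5 / expR (3 / 10 * l)) ^+ 3 <= p ^+ 3.
  by rewrite lerXn2r // nnegrE ltW // divr_gt0.
apply: (@le_trans _ _ (125 * expR (1 / 10 * l))); last first.
  have -> : 125 * expR (1 / 10 * l) = r%:R * (5 / expR (3 / 10 * l)) ^+ 3.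
    rewrite exprMn exprVn -expRM_natr rE mulrCA -expRN -expRD; congr (_ * expR _).
      by rewrite -natrX.
    by lra.
  by rewrite ler_wpM2l // ltW.
have l2 : ln ((2 * r)%:R : R) <= 1 + l.
  rewrite natrM lnM ?posrE // lerD2r -ler_expR lnK ?posrE //.
  by apply: le_trans (expR_ge1Dx 1); lra.
have := @expR_ge1Dxn R (1 / 10 * l) 1; rewrite (_ : 2`!%:R = 2) // => h.
have {}h := h (mulr_ge0 _ _); nra.
Qed.

End HighProbability.

Local Open Scope ring_scope.

Theorem theorem1p2 (R : realType) (eps : R) (p : nat -> R)
    (eps_gt0 : 0 < eps) (eps_lt1 : eps < 1)
    (p01 : forall r : nat, 0 <= p r <= 1) :
  ((forall r : nat, (0 < r)%N -> p r <= (1 - eps) / (r%:R `^ (1 / 2))) ->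
    whp (fun r : nat => rsub2_prob (Krr r) (p r)
      (fun X Y => (2 < num_components (friends_and_strangers X Y))%N)))
  /\
  ((\forall r \near \oo%classic,
      5 * (ln (r%:R : R) `^ (1 / 10)) / (r%:R `^ (3 / 10)) <= p r) ->
    whp (fun r : nat => rsub2_prob (Krr r) (p r)
      (fun X Y => num_components (friends_and_strangers X Y) == 2%N))).
Proof.
split=> pr.
- apply: whp_lower_bound; first last.
  + near=> r; apply: (sparse_prob eps_gt0 eps_lt1 (p01 r)).
      by near: r; exact: nbhs_infty_gt.
    have <- : r%:R `^ (1 / 2) = Num.sqrt r%:R :> R by rewrite div1r powR12_sqrt.
    apply: pr.
    by near: r; exact: nbhs_infty_gt.
  + by move=> r; exact: rsub2_prob_le1.
  + by rewrite divr_ge0 // exprn_even_ge0.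
- apply: (@whp_lower_bound _ _ 2) => //; first by move=> r; exact: rsub2_prob_le1.
  near=> r.
  have rE : expR 2700 <= r%:R :> R by near: r; exact: nbhs_infty_ger.
  have r0 : 0 < r%:R :> R by apply: lt_le_trans rE; exact: expR_gt0.
  have l27 : 2700 <= ln (r%:R : R) by rewrite -ler_expR lnK // posrE.
  have lp : 5 * (ln (r%:R : R) `^ (1 / 10)) / (r%:R `^ (3 / 10)) <= p r by near: r.
  have [p0 Lp] := dense_threshold l27 lp.
  apply: dense_prob => //; first by have /andP[] := p01 r.
  by near: r; exact: nbhs_infty_gt.
Unshelve. all: by end_near.
Qed.
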